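(* Let $\alpha$ be an irreducible, ergodic and nonexpansive automorphism of a compact connected abelian group $X$. Then $\Delta_\alpha(X)=\{0\}$.
   Context: A continuous automorphism $\alpha$ of a compact abelian group $X$ is irreducible if every closed $\alpha$-invariant subgroup $Y\subsetneq X$ is finite. Ergodicity is with respect to Haar measure; nonexpansive means not expansive. $\Delta_\alpha(X)=\{x\in X:\lim_{|n|\to\infty}\alpha^nx=0\}$ is the group of $\alpha$-homoclinic points. *)

(* Defs.v *)
From HB Require Import structures.
From mathcomp Require Import all_boot all_order all_algebra.
From mathcomp Require Import all_classical all_reals all_analysis.

Set Implicit Arguments.
Unset Strict Implicit.
Unset Printing Implicit Defensive.

Import Order.TTheory GRing.Theory Num.Theory.

Local Open Scope classical_set_scope.
Local Open Scope ring_scope.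

(* [g_sigma_algebraType] needs a pointed carrier, and a topological group has no
   canonical [pointedType] structure; this alias is pointed at 0. *)
Definition pointed0 (X : zmodType) : Type := X.
HB.instance Definition _ (X : zmodType) := Choice.on (pointed0 X).
HB.instance Definition _ (X : zmodType) := isPointed.Build (pointed0 X) (0 : X).

(* X with its Borel sigma-algebra *)
Notation borelType X :=
  (g_sigma_algebraType (@open X : set (set (pointed0 X)))).

(* In a compact Hausdorff group the inverse is automatically continuous. *)
Record continuous_automorphism (X : topologicalZmodType) := ContinuousAutomorphism {
  aut_fun :> {additive X -> X};
  aut_inv : X -> X;
  aut_funK : cancel aut_fun aut_inv;
  aut_invK : cancel aut_inv aut_fun;
  aut_continuous : continuous aut_fun
}.

Definition aut_iter (X : topologicalZmodType) (alpha : continuous_automorphism X)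
    (n : int) : X -> X :=
  match n with
  | Posz k => iter k alpha
  | Negz k => iter k.+1 (aut_inv alpha)
  end.

(* alpha @` Y = Y is invariance under the Z-action generated by alpha. *)
Definition irreducible_aut (X : topologicalZmodType)
    (alpha : continuous_automorphism X) : Prop :=
  forall Y : set X, closed Y -> zmod_closed (mem Y) -> alpha @` Y = Y ->
    Y <> [set: X] -> finite_set Y.

Definition expansive_aut (X : topologicalZmodType)
    (alpha : continuous_automorphism X) : Prop :=
  exists2 U : set X, nbhs 0 U &
    \bigcap_(n in [set: int]) (aut_iter alpha n @` U) = [set 0].

(* The filter of |n| --> oo on the integers. *)
Definition int_infty : set_system int :=
  filter_from [set: nat] (fun N => [set n : int | (N <= absz n)%N]).

Global Instance int_infty_filter : ProperFilter int_infty.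
Proof.
apply: filter_from_proper; last by move=> N _; exists (Posz N) => /=.
apply: filter_from_filter; first by exists 0%N.
move=> M N _ _; exists (maxn M N) => // n /=.
by rewrite geq_max => /andP[].
Qed.

Definition homoclinic (X : topologicalZmodType)
    (alpha : continuous_automorphism X) : set X :=
  [set x | aut_iter alpha n x @[n --> int_infty] --> (0 : X)].

Definition regular_measure (R : realType) (X : topologicalZmodType)
    (mu : {measure set (borelType X) -> \bar R}) : Prop :=
  (forall A : set (borelType X), measurable A ->
     mu A = ereal_inf [set mu U | U in [set U : set X | open U /\ A `<=` U]]) /\
  (forall U : set X, open U ->
     mu U = ereal_sup [set mu K | K in [set K : set X | compact K /\ K `<=` U]]).

(* Normalised Haar measure; mu is already a probability. Regularity is not
   automatic for a Borel measure on a nonmetrisable group. *)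
Definition haar_probability (R : realType) (X : topologicalZmodType)
    (mu : probability (borelType X) R) : Prop :=
  regular_measure mu /\
  forall (x : X) (A : set (borelType X)), measurable A ->
    mu [set x + a | a in (A : set X)] = mu A.

(* Invariance of mu under alpha is not required: it follows from the uniqueness
   of Haar measure. *)
Definition ergodic_aut (R : realType) (X : topologicalZmodType)
    (mu : probability (borelType X) R) (alpha : continuous_automorphism X) : Prop :=
  forall A : set (borelType X), measurable A -> alpha @^-1` A = A ->
    mu A = 0%E \/ mu A = 1%E.

(* Main.v *)
Require Import Defs.
From mathcomp Require Import all_boot all_order all_algebra.
From mathcomp Require Import all_classical all_reals all_analysis.
From mathcomp Require Import complex zify ring lra.

(** A character of [X] with values in the circle R/Z is handled through a lift
    [t : X -> R] that is additive modulo the integers ([character]).  A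
    polynomial [f] over the integers acts on characters through [alpha], and
    the proof follows one nontrivial character [t] with [f(alpha) t = 0] modulo
    the integers, the degree of [f] being minimal among all such pairs.

    Nonexpansiveness gives [f] a complex root of modulus 1.  Indeed, when the
    orbit of [x] stays close to the kernel of [t], the small representatives of
    the numbers [t (alpha^n x)] form a bounded real sequence that satisfies the
    linear recurrence attached to [f].  Without roots on the unit circle this
    sequence vanishes, so [x] lies in the closed invariant subgroup where [t]
    is integral along orbits; it is finite by irreducibility, hence it meets a
    small neighbourhood of 0 in 0 only, and [alpha] is expansive
    ([expansive_of_no_unit_root]).  So there is a root [z] with |z| = 1, and
    minimality makes [f] a minimal polynomial of [z] ([critical_character]).

    Let now [x] be homoclinic.  The representatives [v n] of [t (alpha^n x)]
    nearest to 0 tend to 0 at both ends, so [h := f(shift) v] is integral and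
    tends to 0: it has finite support.  Evaluating the generating polynomial of
    [h] at [z] telescopes, because |z| = 1 and [v] vanishes at infinity, and
    the value is 0 ([vanishing_root]).  Hence [f] divides a multiple of that
    polynomial, i.e. [c * h = f(shift) g] for an integer sequence [g] of finite
    support.  The sequence [c * v - g] then solves the recurrence and tends to
    0 at both ends, so it is 0 ([vanishing_kill]); [c * t] is integral along
    the orbit of [x].  This orbit lies in a finite subgroup, where tending to 0
    means being 0 ([homoclinic_trivial]).

    Two facts of harmonic analysis start the argument.

    Nontrivial characters exist ([character_exists]).  Means of continuous
    functions are obtained as limits of averages over finitely many translates.
    For a symmetric function [k] of mean 0, the even convolution powers of [k],
    rescaled by the growth rate of their values at 0, converge uniformly to a
    convolution idempotent, which is a sum of finitely many characters
    ([idempotent_exists]).  An idempotent that is minimal has the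
    form [c * cos(2 pi t)]: this is read off from the cosine equation
    C(x+y) + C(x-y) = 2 C(x) C(y) that minimality forces
    ([dalembert_exists]).

    Some nonzero [f] annihilates [t] ([annihilator_exists]).  Otherwise the
    characters [x |-> t (alpha^i x)] are independent; Kronecker's theorem
    ([kronecker]) and compactness produce, for each time, an orbit along which
    [t] is 1/2 at this time and 0 at all others, and the proper subgroup of the points [x] with [2 * t] integral
    along the orbit would be infinite. *)

Set Implicit Arguments.
Unset Strict Implicit.
Unset Printing Implicit Defensive.

Import Order.TTheory GRing.Theory Num.Theory.
Import numFieldNormedType.Exports.

Local Open Scope classical_set_scope.
Local Open Scope ring_scope.

(** * Invariant means of continuous functions on a compact abelian group *)

Section CompactGroup.
Variables (R : realType) (X : topologicalZmodType).
Hypothesis compactX : compact [set: X].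
Implicit Types (f g : X -> R) (c d e : R) (x y z : X) (a b : seq X).

Lemma continuous_addl (y : X) : continuous (fun x : X => y + x).
Proof.
move=> x; apply: (@continuous_comp _ _ _ (fun x => (y, x)) (fun z : X * X => z.1 + z.2)).
  by apply: cvg_pair; [exact: cvg_cst|exact: cvg_id].
exact: add_continuous.
Qed.

Lemma continuous_addr (y : X) : continuous (fun x : X => x + y).
Proof.
have -> : (fun x : X => x + y) = (fun x => y + x) by apply/funext => x; rewrite addrC.
exact: continuous_addl.
Qed.

Lemma nbhs_translate (x : X) (P : set X) :
  (\forall v \near (0 : X), P (x + v)) -> nbhs x P.
Proof.
move=> H; have := @continuous_addl (- x) x.
rewrite /continuous_at addNr => /(_ _ H) /=; rewrite nbhs_simpl /=.
by apply: filterS => y /=; rewrite addrA subrr add0r.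
Qed.

Lemma unif_cont (f : X -> R) : continuous f -> forall e : R, 0 < e ->
  \forall v \near (0 : X), forall x, `|f (x + v) - f x| <= e.
Proof.
move=> cf e e0.
have /compact_near_coveringP := compactX.
move=> /(_ X (nbhs 0) (fun v x => `|f (x + v) - f x| <= e) _) H.
have {H} : \forall v \near nbhs (0 : X),
  [set: X] `<=` (fun x => `|f (x + v) - f x| <= e).
  apply: H => x _.
  have c2 : {for (x, 0 : X), continuous (fun z : X * X => f (z.1 + z.2) - f z.1)}.
    apply: cvgB.
      apply: (@continuous_comp _ _ _ (fun z : X * X => z.1 + z.2) f).
        exact: add_continuous.
      exact: cf.
    by apply: (@continuous_comp _ _ _ fst f); [exact: cvg_fst|exact: cf].
  have := c2 (ball (f (x + 0) - f x) e).
  move=> /(_ (nbhsx_ballx _ _ e0)) /=.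
  case=> -[A B] /= [nA nB] AB.
  exists (A, B) => //= -[x' v] /= [Ax Bv].
  have := AB (x', v); rewrite /ball /= addr0 subrr sub0r normrN.
  by move=> /(_ (conj Ax Bv)) /ltW.
by apply: filterS => v Hv x; exact: Hv.
Qed.

(** Total boundedness of a compact group, in terms of translates of a
    neighbourhood of 0. *)
Lemma finite_net (V : set X) : nbhs 0 V ->
  exists ys : seq X, forall x, exists2 y, y \in ys & V (x - y).
Proof.
move=> nV.
pose F : set_system (seq X) :=
  filter_from [set: seq X] (fun s => [set t : seq X | {subset s <= t}]).
have FF : Filter F.
  apply: filter_from_filter; first by exists [::].
  move=> s t _ _; exists (s ++ t) => // u su.
  by split=> y ys; apply: su; rewrite mem_cat ys ?orbT.
have /compact_near_coveringP := compactX.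
move=> /(_ (seq X) F (fun s x => exists2 y, y \in s & V (x - y)) FF) [].
  move=> x _; exists ((fun z => V (z - x)), [set t : seq X | x \in t]) => /=.
    split; last by exists [:: x] => // t; apply; rewrite mem_head.
    by apply: (@continuous_addr (- x) x); rewrite /= subrr.
  by move=> [z t] /= [Vz xt]; exists x.
by move=> s _ /(_ s (fun _ h => h)) H; exists s => x; exact: H.
Qed.

Lemma cont_bounded (f : X -> R) : continuous f -> exists B : R, forall x, `|f x| <= B.
Proof.
move=> cf; have [ys ysP] := finite_net (unif_cont cf ltr01).
exists (1 + \sum_(y <- ys) `|f y|) => x; have [y yys /(_ y)] := ysP x.
rewrite subrKC => H.
have : `|f y| <= \sum_(z <- ys) `|f z|.
  by rewrite (big_rem y) //= lerDl sumr_ge0.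
have := ler_normD (f x - f y) (f y); rewrite subrK; lra.
Qed.

Definition avg (a : seq X) (f : X -> R) (x : X) : R :=
  (\sum_(y <- a) f (x + y)) / (size a)%:R.

Lemma avg_le a f g x : (forall y, f y <= g y) -> avg a f x <= avg a g x.
Proof.
by move=> fg; rewrite /avg ler_wpM2r ?invr_ge0 ?ler0n// ler_sum.
Qed.

Lemma avg_cst a c x : (0 < size a)%N -> avg a (fun=> c) x = c.
Proof.
move=> a0; rewrite /avg big_const_seq count_predT iter_addr_0.
by rewrite -[_ *+ _]mulr_natr mulfK// pnatr_eq0 -lt0n.
Qed.

Lemma avgD a f g x : avg a (fun y => f y + g y) x = avg a f x + avg a g x.
Proof. by rewrite /avg big_split mulrDl. Qed.

Lemma avgZ a c f x : avg a (fun y => c * f y) x = c * avg a f x.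
Proof. by rewrite /avg -mulr_sumr mulrA. Qed.

Lemma avg_dist a f c e x : (0 < size a)%N ->
  (forall y, `|f y - c| <= e) -> `|avg a f x - c| <= e.
Proof.
move=> a0 H; rewrite ler_distl; apply/andP; split.
  rewrite -[leLHS](avg_cst (c - e) x a0); apply: avg_le => y.
  by move: (H y); rewrite ler_distl => /andP[].
rewrite -[leRHS](avg_cst (c + e) x a0); apply: avg_le => y.
by move: (H y); rewrite ler_distl => /andP[].
Qed.

Lemma avg_comm a b f x : avg a (avg b f) x = avg b (avg a f) x.
Proof.
rewrite /avg -!mulr_suml exchange_big /= mulrAC; congr (_ / _ / _).
by apply: eq_bigr => y _; apply: eq_bigr => z _; rewrite addrAC.
Qed.

Lemma avg_flat a b f x :
  avg [seq y + z | y <- a, z <- b] f x = avg a (avg b f) x.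
Proof.
rewrite /avg size_allpairs big_allpairs_dep natrM invfM mulrCA mulrC -mulrA.
rewrite mulrA -[in RHS]mulr_suml; congr (_ / _ / _).
by apply: eq_bigr => y _; apply: eq_bigr => z _; rewrite addrA.
Qed.

(** A mean value is characterised without integration, as the constant that is
    uniformly approximated by averages over finitely many translates.  Because
    averaging operators commute, all the formal rules for means (linearity,
    invariance, exchange) become rules for finite sums. *)
Definition is_mean (f : X -> R) (c : R) := forall e, 0 < e ->
  exists2 a : seq X, (0 < size a)%N & forall x, `|avg a f x - c| <= e.

(** Averaging by [a] and by [b] commute, so the double average is close to both
    constants. *)
Lemma is_mean_uniq f c d : is_mean f c -> is_mean f d -> c = d.
Proof.
move=> fc fd; apply/eqP; rewrite -subr_eq0 -normr_eq0 eq_le normr_ge0 andbT.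
apply/ler_addgt0Pl => e e0; rewrite addr0.
have e20 : 0 < e / 2 by rewrite divr_gt0.
have [a a0 Ha] := fc _ e20; have [b b0 Hb] := fd _ e20.
have := avg_dist 0 a0 Hb; rewrite avg_comm.
have := avg_dist 0 b0 Ha.
rewrite distrC => H1 H2.
have := ler_normD (c - avg b (avg a f) 0) (avg b (avg a f) 0 - d).
rewrite addrA subrK; lra.
Qed.

(** The mean is the infimum of the upper bounds of finite averages of [f].  All
    averages share the modulus of continuity of [f]; so if an average whose
    supremum is nearly optimal were low at one point, it would be low on a whole
    neighbourhood, and averaging it over the translates that cover the group
    would lower its supremum below the infimum. *)
Lemma is_mean_exists f : continuous f -> exists c, is_mean f c.
Proof.
move=> cf.
pose S : set R :=
  [set m : R | exists2 a : seq X, (0 < size a)%N & forall x, avg a f x <= m].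
have [B HB] := cont_bounded cf.
have S0 : S !=set0.
  exists B, [:: 0] => // x; rewrite /avg big_seq1 addr0 divr1.
  exact: le_trans (ler_norm _) (HB _).
have lbS : has_lbound S.
  exists (- B) => m [a a0 /(_ 0)]; apply: le_trans.
  rewrite -[leLHS](avg_cst (- B) 0 a0); apply: avg_le => y.
  by have := HB y; rewrite ler_norml => /andP[].
have iS : has_inf S by [].
exists (inf S) => e e0.
have e20 : 0 < e / 2 by rewrite divr_gt0.
have [ys ysP] := finite_net (unif_cont cf e20).
have ys0 : (0 < size ys)%N.
  by have [y] := ysP 0; case: (ys).
set n := (size ys)%:R : R.
have n0 : 0 < n by rewrite ltr0n.
have n1 : 1 <= n by rewrite ler1n.
(* With n translates, lowering one of n values by e / 2 gains more than the
   n - 1 defects h can lose. *)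
pose h : R := e / 2 / n.
have h0 : 0 < h by rewrite !divr_gt0.
have hn : h * n = e / 2 by rewrite /h divfK// gt_eqF.
have [m [a a0 Ha] mlt] := inf_adherent h0 iS.
exists a => // x0; rewrite ler_distl; apply/andP; split; last first.
  apply: le_trans (Ha _) _; have : h <= e / 2 by rewrite -hn ler_peMr// ltW.
  lra.
rewrite leNgt; apply/negP => glt.
pose g := avg a f.
pose b := [seq x0 - y | y <- ys].
have b0 : (0 < size b)%N by rewrite size_map.
have gM x : g x <= inf S + h by apply: le_trans (Ha x) (ltW mlt).
have gV v : (forall x, `|f (x + v) - f x| <= e / 2) -> g (x0 + v) <= inf S - e / 2.
  move=> Hv; have : `|avg a (fun y => f (y + v) + -1 * f y) x0 - 0| <= e / 2.
    by apply: avg_dist => // y; rewrite subr0 mulN1r.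
  rewrite subr0 avgD avgZ.
  have -> : avg a (fun y => f (y + v)) x0 = g (x0 + v).
    by rewrite /g /avg; congr (_ / _); apply: eq_bigr => y _; rewrite addrAC.
  rewrite ler_norml => /andP[_]; rewrite -/g in glt *; lra.
have key x : avg b g x <= inf S - h / n.
  have [y yys Hv] := ysP x.
  have := gV _ Hv => {}Hv.
  have : \sum_(z <- ys) g (x + (x0 - z)) <= inf S - e / 2 + (n - 1) * (inf S + h).
    rewrite (big_rem y)//=; apply: lerD.
      by rewrite addrCA.
    have -> : (n - 1) * (inf S + h) = \sum_(z <- rem y ys) (inf S + h).
      rewrite big_const_seq count_predT iter_addr_0 size_rem// -[RHS]mulr_natr mulrC.
      by congr (_ * _); rewrite -subn1 natrB.
    by apply: ler_sum.
  rewrite /avg big_map size_map -/n ler_pdivrMr// => H; apply: le_trans H _.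
  have hnn : h / n * n = h by rewrite divfK// gt_eqF.
  by rewrite mulrBl mulrBl mul1r mulrDr hnn (mulrC n h) hn (mulrC (inf S) n); lra.
have : inf S <= inf S - h / n.
  apply: ge_inf => //; exists [seq y + z | y <- b, z <- a].
    by rewrite size_allpairs muln_gt0 b0.
  by move=> x; rewrite avg_flat.
have : 0 < h / n by rewrite divr_gt0.
lra.
Qed.

Definition mean (f : X -> R) : R := xget 0 [set c | is_mean f c].

Lemma meanP f : continuous f -> is_mean f (mean f).
Proof. by move=> /is_mean_exists[c fc]; rewrite /mean; case: xgetP => // /(_ c). Qed.

Lemma mean_eq f c : is_mean f c -> mean f = c.
Proof.
move=> fc; rewrite /mean; case: xgetP => [d -> fd|/(_ c)//].
exact: is_mean_uniq fd fc.
Qed.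

Lemma mean_cst c : mean (fun=> c) = c.
Proof.
by apply: mean_eq => e e0; exists [:: 0] => // x; rewrite avg_cst// subrr normr0 ltW.
Qed.

Lemma meanD f g : continuous f -> continuous g ->
  mean (fun x => f x + g x) = mean f + mean g.
Proof.
move=> cf cg; apply: mean_eq => e e0.
have e20 : 0 < e / 2 by rewrite divr_gt0.
have [a a0 Ha] := meanP cf e20; have [b b0 Hb] := meanP cg e20.
exists [seq y + z | y <- a, z <- b]; first by rewrite size_allpairs muln_gt0 a0.
move=> x; rewrite avgD !avg_flat.
have := avg_dist x a0 Hb; have := avg_dist x b0 Ha; rewrite avg_comm.
move=> H1 H2.
have := ler_normD (avg a (avg b f) x - mean f) (avg a (avg b g) x - mean g).
rewrite addrACA -opprD; lra.
Qed.

Lemma meanZ (c : R) (f : X -> R) : continuous f -> mean (fun x => c * f x) = c * mean f.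
Proof.
move=> cf; apply: mean_eq => e e0.
have [a a0 Ha] := meanP cf (divr_gt0 e0 (ltr_wpDl (normr_ge0 c) ltr01)).
exists a => // x; rewrite avgZ -mulrBr normrM.
have c1 : 0 < `|c| + 1 by rewrite ltr_wpDl.
have := Ha x; rewrite ler_pdivlMr// => H.
have := normr_ge0 (avg a f x - mean f); nra.
Qed.

Lemma mean_ge0 (f : X -> R) : continuous f -> (forall x, 0 <= f x) -> 0 <= mean f.
Proof.
move=> cf f0; apply/ler_addgt0Pl => e e0.
have [a a0 /(_ 0)] := meanP cf e0; rewrite ler_distl => /andP[_].
rewrite addrC; apply: le_trans.
by rewrite -[leLHS](avg_cst 0 0 a0); exact: avg_le.
Qed.

Lemma mean_shift f y : continuous f -> mean (fun x => f (x + y)) = mean f.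
Proof.
move=> cf; apply: mean_eq => e e0; have [a a0 Ha] := meanP cf e0; exists a => // x.
have -> : avg a (fun x => f (x + y)) x = avg a f (x + y).
  by rewrite /avg; congr (_ / _); apply: eq_bigr => z _; rewrite addrAC.
exact: Ha.
Qed.

Lemma mean_opp f : continuous f -> mean (fun x => f (- x)) = mean f.
Proof.
move=> cf; apply: mean_eq => e e0; have [a a0 Ha] := meanP cf e0.
exists [seq - z | z <- a]; first by rewrite size_map.
move=> x.
have -> : avg [seq - z | z <- a] (fun x => f (- x)) x = avg a f (- x).
  rewrite /avg size_map big_map; congr (_ / _).
  by apply: eq_bigr => z _; rewrite opprD opprK.
exact: Ha.
Qed.

End CompactGroup.

(** * Continuity rules *)

Section ContinuousRules.
Variables (R : realType) (X : topologicalZmodType).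
Implicit Types f g : X -> R.

Lemma contD f g : continuous f -> continuous g -> continuous (fun x => f x + g x).
Proof. by move=> cf cg x; apply: cvgD; [exact: cf|exact: cg]. Qed.

Lemma contB f g : continuous f -> continuous g -> continuous (fun x => f x - g x).
Proof. by move=> cf cg x; apply: cvgB; [exact: cf|exact: cg]. Qed.

Lemma contM f g : continuous f -> continuous g -> continuous (fun x => f x * g x).
Proof. by move=> cf cg x; apply: cvgM; [exact: cf|exact: cg]. Qed.

Lemma cont_cst (c : R) : continuous (fun _ : X => c).
Proof. by move=> x; exact: cvg_cst. Qed.

Lemma contZ (c : R) f : continuous f -> continuous (fun x => c * f x).
Proof. by apply: contM; exact: cont_cst. Qed.

Lemma cont_addr f y : continuous f -> continuous (fun x => f (x + y)).
Proof.
by move=> cf x; apply: (@continuous_comp _ _ _ (fun x => x + y) f);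
  [exact: continuous_addr|exact: cf].
Qed.

Lemma cont_addl f y : continuous f -> continuous (fun x => f (y + x)).
Proof.
by move=> cf x; apply: (@continuous_comp _ _ _ (fun x => y + x) f);
  [exact: continuous_addl|exact: cf].
Qed.

Lemma cont_opp f : continuous f -> continuous (fun x => f (- x)).
Proof.
by move=> cf x; apply: (@continuous_comp _ _ _ -%R f);
  [exact: opp_continuous|exact: cf].
Qed.

Lemma cont_sub f y : continuous f -> continuous (fun x => f (y - x)).
Proof. by move=> cf; apply: (@cont_opp (fun x => f (y + x))); exact: cont_addl. Qed.

Lemma cont_sum (I : eqType) (s : seq I) (F : I -> X -> R) :
  (forall i, continuous (F i)) -> continuous (fun x => \sum_(i <- s) F i x).
Proof.
move=> cF; elim: s => [|i s IH].
  by under eq_fun do rewrite big_nil; exact: cont_cst.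
by under eq_fun do rewrite big_cons; exact: contD.
Qed.

(** A uniform modulus of continuity at 0 is the form in which continuity of
    means depending on a parameter, and of uniform limits, is obtained. *)
Lemma cont_near0 f :
  (forall e : R, 0 < e -> \forall v \near (0 : X), forall x, `|f (x + v) - f x| <= e) ->
  continuous f.
Proof.
move=> H x; apply/cvgrPdist_le => e e0.
apply: (@nbhs_translate _ x (fun t => `|f x - f t| <= e)).
by apply: filterS (H e e0) => v /(_ x); rewrite distrC.
Qed.

End ContinuousRules.

(** Continuity of real expressions by recursion on their syntax. *)
Ltac cts := solve [ assumption | exact: cont_cst |
  lazymatch goal with |- forall x, continuous_at x ?F =>
  lazymatch eval cbv beta in F with
  | (fun x => @?f x - @?g x) => apply: contB; cts
  | (fun x => @?f x + @?g x) => apply: contD; cts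
  | (fun x => @?f x * @?g x) => apply: contM; cts
  | (fun x => _ (- x)) => apply: cont_opp; cts
  | (fun x => _ (_ - x)) => apply: cont_sub; cts
  | (fun x => _ (_ + x)) => apply: cont_addl; cts
  | (fun x => _ (x + _)) => apply: cont_addr; cts
  end end ].

Lemma mul_le_of_bound (R : realFieldType) (u w B r : R) : 0 <= u -> 0 <= w ->
  u <= r / (`|B| + 1) -> w <= B -> u * w <= r.
Proof.
move=> u0 w0 ur wB; have B1 : 0 < `|B| + 1 by rewrite ltr_wpDl.
move: ur; rewrite ler_pdivlMr//; apply: le_trans; apply: ler_wpM2l => //.
by apply: le_trans wB _; rewrite ler_wpDr// ler_norm.
Qed.

(** * Convolution *)

Section Convolution.
Variables (R : realType) (X : topologicalZmodType).
Hypothesis compactX : compact [set: X].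
Implicit Types (f g h : X -> R) (e c d : R).
Local Notation mean := (@mean R X).

Lemma meanB f g : continuous f -> continuous g ->
  mean (fun x => f x - g x) = mean f - mean g.
Proof.
move=> cf cg.
have -> : (fun x => f x - g x) = (fun x => f x + -1 * g x).
  by apply/funext => x; rewrite mulN1r.
by rewrite meanD//; [rewrite meanZ// mulN1r|exact: contZ].
Qed.

Lemma mean_le f g : continuous f -> continuous g -> (forall x, f x <= g x) ->
  mean f <= mean g.
Proof.
move=> cf cg fg; rewrite -subr_ge0 -meanB//; apply: mean_ge0 => //; first by cts.
by move=> x; rewrite subr_ge0.
Qed.

Lemma mean_dist f g e : continuous f -> continuous g ->
  (forall x, `|f x - g x| <= e) -> `|mean f - mean g| <= e.
Proof.
move=> cf cg fg; rewrite -meanB// ler_norml.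
have cfg : continuous (fun x => f x - g x) by cts.
rewrite -[X in X <= _ <= _](mean_cst X (- e)) -[X in _ <= _ <= X](mean_cst X e).
apply/andP; split; apply: mean_le => //; first 1 [exact: cont_cst | idtac].
- by move=> x; have := fg x; rewrite ler_norml => /andP[].
- exact: cont_cst.
- by move=> x; have := fg x; rewrite ler_norml => /andP[].
Qed.

Lemma mean_sum (I : eqType) (s : seq I) (F : I -> X -> R) :
  (forall i, continuous (F i)) ->
  mean (fun x => \sum_(i <- s) F i x) = \sum_(i <- s) mean (F i).
Proof.
move=> cF; elim: s => [|i s IH].
  by under eq_fun do rewrite big_nil; rewrite mean_cst big_nil.
under eq_fun do rewrite big_cons.
by rewrite meanD//; [rewrite IH big_cons|exact: cont_sum].
Qed.

Lemma mean_sub f x : continuous f -> mean (fun y => f (x - y)) = mean f.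
Proof.
move=> cf; rewrite (@mean_opp _ _ compactX (fun y => f (x + y))); last by cts.
rewrite -[RHS](mean_shift compactX x cf).
by congr mean; apply/funext => y; rewrite addrC.
Qed.

(** Finitely many translates of a neighbourhood where [f] is bounded below
    cover the group, so a sum of translates of [f] is bounded below. *)
Lemma mean_gt0 f : continuous f -> (forall x, 0 <= f x) ->
  (exists x, f x != 0) -> 0 < mean f.
Proof.
move=> cf f0 [x0 fx0].
have d0 : 0 < f x0 / 2 by rewrite divr_gt0// lt_neqAle eq_sym fx0 f0.
have [ys ysP] := finite_net compactX (unif_cont compactX cf d0).
have ys0 : (0 < size ys)%N by have [y] := ysP 0; case: (ys).
have n0 : 0 < (size ys)%:R :> R by rewrite ltr0n.
suff H : forall x, f x0 / 2 <= \sum_(y <- ys) f (x + (x0 - y)).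
  have : f x0 / 2 <= mean (fun x => \sum_(y <- ys) f (x + (x0 - y))).
    rewrite -[leLHS](mean_cst X); apply: mean_le => //; first exact: cont_cst.
    by apply: cont_sum => y; cts.
  rewrite mean_sum; last by move=> y; cts.
  under eq_bigr do rewrite mean_shift//.
  rewrite big_const_seq count_predT iter_addr_0 -[X in _ <= X]mulr_natr => H'.
  by rewrite -(pmulr_lgt0 _ n0); exact: lt_le_trans H'.
move=> x; have [y yys /(_ x0) Hv] := ysP x.
rewrite (big_rem y)//=.
have : 0 <= \sum_(z <- rem y ys) f (x + (x0 - z)) by apply: sumr_ge0.
move: Hv; rewrite ler_distl addrCA => /andP[+ _]; lra.
Qed.

(** The quadratic form of [s f + t g] is nonnegative. *)
Lemma cauchy_schwarz f g : continuous f -> continuous g ->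
  mean (fun x => f x * g x) ^+ 2 <=
  mean (fun x => f x * f x) * mean (fun x => g x * g x).
Proof.
move=> cf cg.
set a := mean (fun x => f x * f x); set b := mean (fun x => f x * g x).
set c := mean (fun x => g x * g x).
have a0 : 0 <= a by apply: mean_ge0 => // [|x]; [cts|rewrite -expr2 sqr_ge0].
have c0 : 0 <= c by apply: mean_ge0 => // [|x]; [cts|rewrite -expr2 sqr_ge0].
have key (s t : R) : 0 <= s ^+ 2 * a + (s * t *+ 2) * b + t ^+ 2 * c.
  have : 0 <= mean (fun x => (s * f x + t * g x) * (s * f x + t * g x)).
    by apply: mean_ge0 => // [|x]; [cts|rewrite -expr2 sqr_ge0].
  have -> : (fun x => (s * f x + t * g x) * (s * f x + t * g x)) =
     (fun x => (s ^+ 2 * (f x * f x) + (s * t *+ 2) * (f x * g x)) + t ^+ 2 * (g x * g x)).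
    by apply/funext => x; ring.
  have cff : continuous (fun x => f x * f x) by cts.
  have cfg : continuous (fun x => f x * g x) by cts.
  have cgg : continuous (fun x => g x * g x) by cts.
  by rewrite meanD ?meanD ?meanZ//; cts.
have [c00|cn0] := eqVneq c 0.
  (* With c = 0 these values turn the form into - b ^ 2 (a + 2). *)
  have := key b (- (a + 1)); rewrite c00 !mulr0 addr0.
  have -> : b ^+ 2 * a + (b * - (a + 1) *+ 2) * b = - (b ^+ 2 * (a + 2)).
    by move: (a) (b) => u v; ring.
  by rewrite oppr_ge0 pmulr_lle0// ltr_wpDl.
have := key c (- b); have : 0 < c by rewrite lt_neqAle eq_sym cn0.
move=> cp H; have : 0 <= c * (c * a - b ^+ 2) by rewrite !expr2 in H *; nra.
by rewrite pmulr_rge0// subr_ge0 mulrC.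
Qed.

(** Averaging sets compose, so finitely many functions can be averaged by the
    same one. *)
Lemma common_avg (phi : X -> X -> R) (s : seq X) e :
  0 < e -> (forall y, continuous (phi y)) ->
  exists2 a : seq X, (0 < size a)%N &
    forall y, y \in s -> forall z, `|avg a (phi y) z - mean (phi y)| <= e.
Proof.
move=> e0 cphi; elim: s => [|y s [a a0 Ha]]; first by exists [:: 0].
have [b b0 Hb] := meanP compactX (cphi y) e0.
exists [seq u + v | u <- a, v <- b]; first by rewrite size_allpairs muln_gt0 a0.
move=> z; rewrite in_cons => /orP[/eqP ->|zs] w; rewrite avg_flat.
  exact: avg_dist.
by rewrite avg_comm; apply: avg_dist => // t; exact: Ha.
Qed.

Definition convol f g x := mean (fun y => f (x - y) * g y).

(** Uniformly in [x], one finite average computes the convolution at [x]: the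
    functions [y |-> f (x - y) * g y] form a totally bounded family.  This plays
    the role of Fubini's theorem. *)
Lemma convol_avg f g e : continuous f -> continuous g -> 0 < e ->
  exists2 a : seq X, (0 < size a)%N &
    forall x z, `|avg a (fun y => f (x - y) * g y) z - convol f g x| <= e.
Proof.
move=> cf cg e0.
have [B HB] := cont_bounded compactX cg.
have B1 : 0 < `|B| + 1 by rewrite ltr_wpDl.
have e30 : 0 < e / 3 by rewrite divr_gt0.
have [ys ysP] := finite_net compactX (unif_cont compactX cf (divr_gt0 e30 B1)).
pose phi x y := f (x - y) * g y.
have cphi x : continuous (phi x) by rewrite /phi; cts.
have [a a0 Ha] := common_avg ys e30 cphi.
exists a => // x z; have [y yys Hv] := ysP x.
have D t : `|phi x t - phi y t| <= e / 3.
  rewrite /phi -mulrBl normrM.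
  by have := Hv (y - t); rewrite [y - t + _]addrC addrA subrK => H;
    exact: mul_le_of_bound H (HB t).
have H1 := mean_dist (cphi x) (cphi y) D.
have H2 : `|avg a (phi x) z - avg a (phi y) z| <= e / 3.
  have := @avg_dist _ _ a (fun t => phi x t - phi y t) 0 (e / 3) z a0.
  rewrite subr0.
  have -> : avg a (fun t => phi x t - phi y t) z = avg a (phi x) z - avg a (phi y) z.
    by rewrite /avg sumrB mulrBl.
  by apply => t; rewrite subr0.
have H3 := Ha y yys z.
rewrite /convol -/(phi x).
have -> : avg a (phi x) z - mean (phi x) = (avg a (phi x) z - avg a (phi y) z) +
  (avg a (phi y) z - mean (phi y)) - (mean (phi x) - mean (phi y)) by ring.
apply: le_trans (ler_normB _ _) _; apply: le_trans (lerD (ler_normD _ _) (lexx _)) _.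
lra.
Qed.

Lemma convol_cont f g : continuous f -> continuous g -> continuous (convol f g).
Proof.
move=> cf cg; apply: cont_near0 => e e0.
have [B HB] := cont_bounded compactX cg.
have B1 : 0 < `|B| + 1 by rewrite ltr_wpDl.
apply: filterS (unif_cont compactX cf (divr_gt0 e0 B1)) => v Hv x.
apply: mean_dist => [||y]; [by cts|by cts|].
rewrite -mulrBl normrM addrAC.
exact: mul_le_of_bound (Hv (x - y)) (HB y).
Qed.

Lemma convolC f g : continuous f -> continuous g -> convol f g = convol g f.
Proof.
move=> cf cg; apply/funext => x; rewrite /convol.
rewrite -(@mean_sub (fun y => g (x - y) * f y) x); last by cts.
by congr mean; apply/funext => y; rewrite mulrC subKr.
Qed.

(** Up to a small error, convolution by [g] is a finite combination of
    translations, and translations commute with convolution by [h]. *)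
Lemma convol_swap f g h : continuous f -> continuous g -> continuous h ->
  convol (convol f g) h = convol (convol f h) g.
Proof.
move=> cf cg ch; apply/funext => x.
apply/eqP; rewrite -subr_eq0 -normr_eq0 eq_le normr_ge0 andbT.
apply/ler_addgt0Pl => e e0; rewrite addr0.
have [B HB] := cont_bounded compactX ch.
have B1 : 0 < `|B| + 1 by rewrite ltr_wpDl.
have e20 : 0 < e / 2 by rewrite divr_gt0.
have [a a0 Ha] := convol_avg cf cg (divr_gt0 e20 B1).
have [b b0 Hb] := convol_avg (convol_cont cf ch) cg e20.
pose c := [seq u + v | u <- a, v <- b].
have Hc z : `|avg c (fun y => f (z - y) * g y) 0 - convol f g z| <= e / 2 / (`|B| + 1).
  by rewrite avg_flat avg_comm; apply: avg_dist => // t; exact: Ha.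
have Hc' : `|avg c (fun y => convol f h (x - y) * g y) 0 -
    convol (convol f h) g x| <= e / 2.
  by rewrite avg_flat; apply: avg_dist => // t; exact: Hb.
have E : mean (fun t => avg c (fun y => f (x - t - y) * g y) 0 * h t) =
   avg c (fun y => convol f h (x - y) * g y) 0.
  rewrite /avg.
  have -> : (fun t => (\sum_(y <- c) f (x - t - (0 + y)) * g (0 + y)) / (size c)%:R * h t) =
    (fun t => \sum_(y <- c) (g y / (size c)%:R) * (f (x - y - t) * h t)).
    apply/funext => t; rewrite mulr_suml mulr_suml; apply: eq_bigr => y _.
    by rewrite add0r addrAC; ring.
  rewrite mean_sum; last by move=> y; cts.
  rewrite mulr_suml; apply: eq_bigr => y _.
  rewrite meanZ//; last by cts.
  by rewrite add0r -/(convol f h (x - y)); move: (convol _ _ _) (g y) _^-1 => u v w; ring.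
have : `|convol (convol f g) h x - avg c (fun y => convol f h (x - y) * g y) 0| <= e / 2.
  rewrite -E; apply: mean_dist.
  - by apply: contM => //; apply: cont_sub; exact: convol_cont.
  - apply: contM => //; rewrite /avg.
    under eq_fun do rewrite mulr_suml; apply: cont_sum => y.
    by apply: contM; [|exact: cont_cst]; apply: contM; [|exact: cont_cst];
      apply: (@cont_sub _ _ (fun t => f (t - (0 + y)))); exact: cont_addr.
  - move=> t; rewrite -mulrBl normrM distrC.
    exact: mul_le_of_bound (Hc (x - t)) (HB t).
move: Hc'; move: (avg c _ 0) => w Hc' H.
have := ler_normD (convol (convol f g) h x - w) (w - convol (convol f h) g x).
rewrite addrA subrK; lra.
Qed.

Lemma convolA f g h : continuous f -> continuous g -> continuous h ->
  convol f (convol g h) = convol (convol f g) h.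
Proof.
move=> cf cg ch; rewrite convolC//; last exact: convol_cont.
by rewrite convol_swap// (convolC cg cf).
Qed.

End Convolution.

(** * Uniform limits *)

Section UniformLimits.
Variables (R : realType) (X : topologicalZmodType).
Hypothesis compactX : compact [set: X].
Implicit Types (f g h q F G : X -> R) (u : nat -> X -> R) (e c d : R).

Definition ucvg u F := forall e, 0 < e ->
  exists N, forall n, (N <= n)%N -> forall x, `|u n x - F x| <= e.

Lemma ucvg_uniq u F G : ucvg u F -> ucvg u G -> F = G.
Proof.
move=> uF uG; apply/funext => x.
apply/eqP; rewrite -subr_eq0 -normr_eq0 eq_le normr_ge0 andbT.
apply/ler_addgt0Pl => e e0; rewrite addr0.
have e20 : 0 < e / 2 by rewrite divr_gt0.
have [N HN] := uF _ e20; have [M HM] := uG _ e20.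
have := HN (N + M)%N (leq_addr _ _) x; have := HM (N + M)%N (leq_addl _ _) x.
move=> H1; rewrite distrC => H2.
have := ler_normD (F x - u (N + M)%N x) (u (N + M)%N x - G x).
rewrite addrA subrK; lra.
Qed.

Lemma ucvg_cst F : ucvg (fun=> F) F.
Proof. by move=> e e0; exists 0%N => n _ x; rewrite subrr normr0 ltW. Qed.

Lemma ucvg_sub u F (s : nat -> nat) : (forall n, (n <= s n)%N) -> ucvg u F ->
  ucvg (fun n => u (s n)) F.
Proof.
move=> sinT uF e /uF[N HN]; exists N => n Nn; apply: HN.
exact: leq_trans (sinT n).
Qed.

Lemma ucvgZ u F c : ucvg u F -> ucvg (fun n x => c * u n x) (fun x => c * F x).
Proof.
move=> uF e e0; have c1 : 0 < `| `|c| | + 1 by rewrite ltr_wpDl.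
have [N HN] := uF _ (divr_gt0 e0 c1); exists N => n Nn x.
rewrite -mulrBr mulrC normrM; exact: mul_le_of_bound (HN n Nn x) (lexx _).
Qed.

Lemma ucvg_convol u F q : (forall n, continuous (u n)) -> continuous F -> continuous q ->
  ucvg u F -> ucvg (fun n => convol q (u n)) (convol q F).
Proof.
move=> cu cF cq uF e e0; have [B HB] := cont_bounded compactX cq.
have c1 : 0 < `|B| + 1 by rewrite ltr_wpDl.
have [N HN] := uF _ (divr_gt0 e0 c1); exists N => n Nn x.
have cun := cu n.
apply: mean_dist => //; [by cts|by cts|] => y.
rewrite -mulrBr mulrC normrM; apply: mul_le_of_bound (HN n Nn y) _ => //.
Qed.

Lemma ucauchy_cvg u : (forall n, continuous (u n)) ->
  (forall e, 0 < e -> exists N, forall m n, (N <= m)%N -> (N <= n)%N ->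
     forall x, `|u m x - u n x| <= e) ->
  exists2 F, continuous F & ucvg u F.
Proof.
move=> cu H.
have cv x : cvgn (fun n => u n x).
  apply/cauchy_cvgP; apply/cauchy_exP => e e0.
  have e20 : 0 < e / 2 by rewrite divr_gt0.
  have [N HN] := H _ e20; exists (u N x); exists N => // n /= Nn.
  rewrite -ball_normE /=; apply: le_lt_trans (HN _ _ (leqnn N) Nn x) _.
  lra.
pose F x := limn (fun n => u n x).
have uF : ucvg u F.
  move=> e e0; have [N HN] := H _ e0; exists N => n Nn x.
  rewrite ler_distlC; apply/andP; split.
    apply: limr_ge; first exact: cv.
    exists N => // m /= Nm; have := HN _ _ Nm Nn x.
    by rewrite ler_distl => /andP[].
  apply: limr_le; first exact: cv.
  exists N => // m /= Nm; have := HN _ _ Nm Nn x.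
  by rewrite ler_distl => /andP[].
exists F => //; apply: cont_near0 => e e0.
have e30 : 0 < e / 3 by rewrite divr_gt0.
have [N HN] := uF _ e30.
apply: filterS (unif_cont compactX (cu N) e30) => v Hv x.
have H1 := HN N (leqnn N) (x + v); have H2 := HN N (leqnn N) x; have H3 := Hv x.
have -> : F (x + v) - F x =
    (u N x - F x) + (u N (x + v) - u N x) - (u N (x + v) - F (x + v)).
  by move: (F _) (F _) (u N _) (u N _) => r1 r2 r3 r4; ring.
apply: le_trans (ler_normB _ _) _; apply: le_trans (lerD (ler_normD _ _) (lexx _)) _.
lra.
Qed.

Lemma convolZr f g c : continuous f -> continuous g ->
  convol f (fun x => c * g x) = (fun x => c * convol f g x).
Proof.
move=> cf cg; apply/funext => x; rewrite /convol -meanZ//; last by cts.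
by congr mean; apply/funext => y; rewrite mulrCA.
Qed.

Lemma convol_sym f g : continuous f -> continuous g ->
  (forall x, f (- x) = f x) -> (forall x, g (- x) = g x) ->
  forall x, convol f g (- x) = convol f g x.
Proof.
move=> cf cg fs gs x; rewrite /convol -mean_opp//; last by cts.
congr mean; apply/funext => y; rewrite gs; congr (_ * _).
by rewrite -fs opprB opprK addrC.
Qed.

Lemma convol0_sym f g : (forall x, f (- x) = f x) ->
  convol f g 0 = mean (fun y => f y * g y).
Proof. by move=> fs; congr mean; apply/funext => y; rewrite sub0r fs. Qed.

Lemma convol_bound f g x : continuous f -> continuous g ->
  convol f g x ^+ 2 <= mean (fun y => f y * f y) * mean (fun y => g y * g y).
Proof.
move=> cf cg; have := @cauchy_schwarz _ _ compactX (fun y => f (x - y)) g.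
rewrite (@mean_sub _ _ compactX (fun y => f y * f y)); last by cts.
by apply => //; cts.
Qed.

End UniformLimits.

(** * Power iteration: idempotents for convolution *)

Section PowerIteration.
Variables (R : realType) (X : topologicalZmodType).
Hypothesis compactX : compact [set: X].
Variable k : X -> R.
Hypotheses (ck : continuous k) (ksym : forall x, k (- x) = k x)
  (kn0 : exists x, k x != 0).

(** [pw n] is the [n.+1]-st convolution power of [k]. *)
Let pw n := iter n (convol k) k.

Let pw_cont n : continuous (pw n).
Proof. by elim: n => //= n IH; exact: convol_cont. Qed.

Let pw_sym n x : pw n (- x) = pw n x.
Proof. by elim: n x => //= n IH x; exact: convol_sym. Qed.

Let pw_add m n : convol (pw m) (pw n) = pw (m + n).+1.
Proof. by elim: m => //= m IH; rewrite -convolA// IH. Qed.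

(** In terms of Fourier coefficients [c] of [k], [a n] is the sum of the powers
    [c ^ (2 n + 2)]; this explains its log-convexity and submultiplicativity,
    which are proved here without Fourier theory. *)
Let a n := mean (fun x => pw n x * pw n x).

Let pw_mean m n : mean (fun x => pw m x * pw n x) = pw (m + n).+1 0.
Proof. by rewrite -convol0_sym// pw_add. Qed.

Let aE n : a n = pw (n + n).+1 0. Proof. exact: pw_mean. Qed.

Let a_convex n : a n.+1 ^+ 2 <= a n * a n.+2.
Proof.
rewrite aE; have -> : (n.+1 + n.+1 = n + n.+2)%N by rewrite addSnnS.
by rewrite -pw_mean; apply: cauchy_schwarz.
Qed.

Let pw_bound n x : `|pw (n + n).+1 x| <= a n.
Proof.
have an : 0 <= a n.
  by apply: mean_ge0 => // [|y]; [exact: contM|rewrite -expr2 sqr_ge0].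
rewrite -ler_sqr ?nnegrE// real_normK ?num_real// -pw_add.
by rewrite [leRHS]expr2; apply: convol_bound.
Qed.

Let a_submul m n : a (m + n).+1 <= a m * a n.
Proof.
rewrite aE.
have -> : ((m + n).+1 + (m + n).+1 = (m + m).+1 + (n + n).+1)%N by lia.
rewrite -pw_mean -[leRHS](mean_cst X); apply: mean_le => //.
- exact: contM.
- exact: cont_cst.
- move=> x; apply: le_trans (ler_norm _) _; rewrite normrM.
  by apply: ler_pM.
Qed.

Let a_gt0 n : 0 < a n.
Proof.
have sq (f : X -> R) : continuous f -> (exists x, f x != 0) ->
    0 < mean (fun x => f x * f x).
  move=> cf [x fx]; apply: mean_gt0 => //; first exact: contM.
    by move=> y; rewrite -expr2 sqr_ge0.
  by exists x; rewrite mulf_neq0.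
have a0 : 0 < a 0%N by exact: sq.
elim: n {-2}n (leqnn n) => [[]//|N IH [//|[_|n]]].
  apply: sq => //; exists 0; have := aE 0; rewrite addn0 => <-.
  by rewrite gt_eqF.
rewrite ltnS => nN; have := a_convex n.
have an : 0 < a n by apply: IH; exact: leq_trans nN.
have an1 : 0 < a n.+1 by exact: IH.
move=> H; rewrite -(pmulr_rgt0 _ an); apply: lt_le_trans H.
by rewrite exprn_gt0.
Qed.

(** The ratios increase by convexity and are bounded by submultiplicativity;
    their limit [lam] is the largest squared Fourier coefficient. *)
Let r n := a n.+1 / a n.

Let r_gt0 n : 0 < r n. Proof. by rewrite divr_gt0. Qed.

Let r_nd : nondecreasing_seq r.
Proof.
apply/nondecreasing_seqP => n; rewrite /r ler_pdivrMr// mulrAC ler_pdivlMr//.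
by rewrite -expr2 mulrC; exact: a_convex.
Qed.

Let r_ub n : r n <= a 0%N.
Proof. by rewrite /r ler_pdivrMr// -[X in a X.+1]add0n; exact: a_submul. Qed.

Let lam := limn r.

Let r_cvg : r n @[n --> \oo] --> lam.
Proof.
by apply: nondecreasing_is_cvgn => //; exists (a 0%N) => _ [n _ <-].
Qed.

Let r_le n : r n <= lam.
Proof.
by apply: nondecreasing_cvgn_le => //; apply/cvg_ex; exists lam.
Qed.

Let lam_gt0 : 0 < lam. Proof. exact: lt_le_trans (r_gt0 0) (r_le 0). Qed.

Let aS n : a n.+1 <= lam * a n. Proof. by rewrite -ler_pdivrMr//; exact: r_le. Qed.

(** The ratios after [n] are at least [r n], so [a (n + m.+1)] is at least
    [r n ^+ m.+1 * a n], while submultiplicativity bounds it by [a n * a m]. *)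
Let r_pow n m : r n ^+ m.+1 <= a m.
Proof.
have H j : r n ^+ j * a n <= a (n + j)%N.
  elim: j => [|j IH]; first by rewrite mul1r addn0.
  rewrite addnS exprS -mulrA; apply: (@le_trans _ _ (r n * a (n + j)%N)).
    by rewrite ler_pM2l.
  by rewrite -ler_pdivlMr//; apply: r_nd; rewrite leq_addr.
rewrite -(ler_pM2r (a_gt0 n)); apply: le_trans (H m.+1) _.
by rewrite addnS mulrC; exact: a_submul.
Qed.

Let lam_pow m : lam ^+ m.+1 <= a m.
Proof.
have : r n ^+ m.+1 @[n --> \oo] --> lam ^+ m.+1.
  exact: (cvg_comp _ _ r_cvg (@exprn_continuous R m.+1 lam)).
move=> cv; rewrite -(cvg_lim _ cv)//; apply: limr_le.
  by apply/cvg_ex; exists (lam ^+ m.+1).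
by near=> n; exact: r_pow.
Unshelve. all: by end_near. Qed.

(** A decreasing sequence bounded below by 1: the lower bound is what makes the
    limit of [P] nonzero. *)
Let b n := a n / lam ^+ n.+1.

Let b_ge1 n : 1 <= b n.
Proof. by rewrite /b ler_pdivlMr ?exprn_gt0// mul1r; exact: lam_pow. Qed.

Let b_cvg : cvgn b.
Proof.
apply: nonincreasing_is_cvgn.
  apply/nonincreasing_seqP => n; rewrite /b ler_pdivrMr ?exprn_gt0//.
  by rewrite [lam ^+ n.+2]exprS mulrCA divfK ?expf_neq0 ?gt_eqF//; exact: aS.
by exists 1 => _ [n _ <-].
Qed.

Let P n x := (lam ^+ n.+1)^-1 * pw (n + n).+1 x.

Let P_cont n : continuous (P n). Proof. exact: contZ. Qed.

Let convol_PP m n : convol (P m) (P n) = P (m + n).+1.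
Proof.
rewrite convolZr// convolC// convolZr// convolC// pw_add.
apply/funext => x; rewrite /P mulrA -invfM -exprD; congr (_^-1 * pw _ x).
  by congr (_ ^+ _); lia.
by lia.
Qed.

Let P_sym n x : P n (- x) = P n x. Proof. by rewrite /P pw_sym. Qed.

Let P0 n : P n 0 = b n. Proof. by rewrite /P -aE mulrC. Qed.

Let PS n : P n.+1 = (fun x => lam^-1 * convol (pw 1) (P n) x).
Proof.
rewrite convolZr// pw_add; apply/funext => x; rewrite /P mulrA -invfM -exprS.
by congr (_ * pw _ x); lia.
Qed.

(** Convolution with the fixed function [pw 1] turns the estimate in quadratic
    mean into a uniform one. *)
Let P_dist m n x : (P m.+1 x - P n.+1 x) ^+ 2 <=
  lam^-1 ^+ 2 * a 1%N * (b (m + m).+1 - b (m + n).+1 *+ 2 + b (n + n).+1).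
Proof.
rewrite !PS -mulrBr exprMn -mulrA ler_pM2l ?exprn_gt0 ?invr_gt0//.
have c1 := @pw_cont 1; have cPm := @P_cont m; have cPn := @P_cont n.
have -> : convol (pw 1) (P m) x - convol (pw 1) (P n) x =
    convol (pw 1) (fun y => P m y - P n y) x.
  rewrite /convol -meanB//; [|by cts|by cts].
  by congr mean; apply/funext => y; rewrite mulrBr.
apply: le_trans (convol_bound _ _ _ _) _ => //; first exact: contB.
have -> // : mean (fun y => (P m y - P n y) * (P m y - P n y)) =
   b (m + m).+1 - b (m + n).+1 *+ 2 + b (n + n).+1.
have PP i j : mean (fun y => P i y * P j y) = b (i + j).+1.
  by rewrite -convol0_sym// convol_PP P0.
have -> : (fun y => (P m y - P n y) * (P m y - P n y)) =
  (fun y => P m y * P m y - 2 * (P m y * P n y) + P n y * P n y).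
  by apply/funext => y; move: (P m y) (P n y) => s t; ring.
have cPP i j : continuous (fun y => P i y * P j y) by exact: contM.
rewrite meanD//; [|by apply: contB => //; exact: contZ].
rewrite meanB//; [|exact: contZ].
by rewrite meanZ// !PP mulr_natl.
Qed.

(** The limit [F] of the rescaled powers [P n] is an idempotent.  The last clause
    says that [F] belongs to the closed ideal generated by [k]: every
    eigenvalue equation for [k] passes to [F]. *)
Lemma idempotent_exists : exists (F : X -> R) (lambda : R),
  [/\ continuous F, forall x, F (- x) = F x, exists x, F x != 0, convol F F = F &
      [/\ 0 < lambda, convol (convol k k) F = (fun x => lambda * F x) &
      forall (q : X -> R) (c : R), continuous q -> convol q k = (fun x => c * k x) ->
        convol q F = (fun x => c * F x)]].
Proof.
have [F cF PF] : exists2 F, continuous F & ucvg P F.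
  apply: ucauchy_cvg => // e e0.
  pose K : R := lam^-1 ^+ 2 * a 1%N * 4.
  have K0 : 0 < K by rewrite !mulr_gt0 ?exprn_gt0 ?invr_gt0.
  have d0 : 0 < e ^+ 2 / K by rewrite divr_gt0 ?exprn_gt0.
  have /cvgrPdist_le /(_ _ d0) [N _ HN] := b_cvg.
  exists N.+1 => -[//|m] [//|n]; rewrite !ltnS => Nm Nn x.
  have e0' := ltW e0.
  rewrite -ler_sqr ?nnegrE// real_normK ?num_real//.
  apply: le_trans (P_dist _ _ _) _.
  have Q i j : (N <= i)%N -> `|limn b - b (i + j).+1| <= e ^+ 2 / K.
    by move=> Ni; apply: HN => /=; lia.
  have := Q m m Nm; have := Q m n Nm; have := Q n n Nn.
  rewrite !ler_distl => /andP[A1 A2] /andP[B1 B2] /andP[C1 C2].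
  have -> : e ^+ 2 = lam^-1 ^+ 2 * a 1%N * (4 * (e ^+ 2 / K)).
    have -> : lam^-1 ^+ 2 * a 1%N * (4 * (e ^+ 2 / K)) = K * (e ^+ 2 / K).
      by rewrite (mulrA (lam^-1 ^+ 2 * a 1%N) 4).
    by rewrite [RHS]mulrC divfK// gt_eqF.
  by rewrite ler_pM2l ?mulr_gt0 ?exprn_gt0 ?invr_gt0//; lra.
have shift : ucvg (fun n => P n.+1) F by apply: ucvg_sub PF => n; exact: leqnSn.
have FP m : convol (P m) F = F.
  apply: (@ucvg_uniq _ _ (fun n => convol (P m) (P n))).
    exact: ucvg_convol.
  have -> : (fun n => convol (P m) (P n)) = (fun n => P (m + n).+1).
    by apply/funext => n; rewrite convol_PP.
  by apply: ucvg_sub PF => n; lia.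
exists F, lam; split => //.
- move=> x; suff FN : F = (fun x => F (- x)) by rewrite [in RHS]FN.
  apply: (@ucvg_uniq _ _ P) => // e /PF[N HN]; exists N => n Nn y.
  by rewrite -P_sym; exact: HN.
- exists 0; have [N HN] := PF (1/2) ltac:(lra).
  have := HN N (leqnn N) 0; rewrite P0 ler_distl => /andP[_ H].
  by have := b_ge1 N => H2; apply/eqP => F0; rewrite F0 in H; lra.
- apply: (@ucvg_uniq _ _ (fun n => convol F (P n))); first exact: ucvg_convol.
  have -> : (fun n => convol F (P n)) = (fun=> F).
    by apply/funext => n; rewrite convolC.
  exact: ucvg_cst.
split => //.
- apply: (@ucvg_uniq _ _ (fun n => convol (pw 1) (P n))); first exact: ucvg_convol.
  have -> : (fun n => convol (pw 1) (P n)) = (fun n x => lam * P n.+1 x).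
    by apply/funext => n; apply/funext => x; rewrite PS mulrA divff ?mul1r// gt_eqF.
  exact: ucvgZ.
- move=> q c cq qk.
  have qpw n : convol q (pw n) = (fun x => c * pw n x).
    elim: n => //= n IH; rewrite convolA// qk convolC//; last exact: contZ.
    by rewrite convolZr// convolC.
  apply: (@ucvg_uniq _ _ (fun n => convol q (P n))); first exact: ucvg_convol.
  have -> : (fun n => convol q (P n)) = (fun n x => c * P n x).
    apply/funext => n; rewrite convolZr// qpw.
    by apply/funext => x; rewrite mulrCA.
  exact: ucvgZ.
Qed.

End PowerIteration.

(** * Minimal idempotents satisfy the cosine equation *)

Section MinimalIdempotent.
Variables (R : realType) (X : topologicalZmodType).
Hypothesis compactX : compact [set: X].
Implicit Types (f g h q p : X -> R) (c : R).

Lemma convolD f g h : continuous f -> continuous g -> continuous h ->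
  convol f (fun x => g x + h x) = (fun x => convol f g x + convol f h x).
Proof.
move=> cf cg ch; apply/funext => x; rewrite /convol -meanD//; [|by cts|by cts].
by congr mean; apply/funext => y; rewrite mulrDr.
Qed.

Lemma convol_shift f g y : continuous f -> continuous g ->
  convol f (fun x => g (x + y)) = (fun x => convol f g (x + y)).
Proof.
move=> cf cg; rewrite convolC//; last by cts.
rewrite (convolC compactX cf cg); apply/funext => x; rewrite /convol.
by congr mean; apply/funext => t; rewrite addrAC.
Qed.

Definition convol_idempotent p := [/\ continuous p, forall x, p (- x) = p x,
  exists x, p x != 0, convol p p = p & mean p = 0].

(** Since [p = p * p], the value [p 0] is the mean of [p ^ 2], and it bounds
    [p] by Cauchy-Schwarz; so [p 0 <= (p 0) ^ 2].  This gap above 0 is what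
    makes minimal idempotents exist. *)
Lemma idempotent_ge1 p : convol_idempotent p -> 1 <= p 0.
Proof.
move=> [cp sp [x0 px0] pp _].
have cpp : continuous (fun x => p x * p x) by cts.
have E : p 0 = mean (fun y => p y * p y) by rewrite -{1}pp convol0_sym.
have p0 : 0 < p 0.
  rewrite E; apply: mean_gt0 => //; first by move=> y; rewrite -expr2 sqr_ge0.
  by exists x0; rewrite mulf_neq0.
have H x : p x ^+ 2 <= p 0 ^+ 2.
  by rewrite -{1}pp [leRHS]expr2 E; exact: convol_bound.
have : p 0 <= p 0 ^+ 2.
  rewrite {1}E -[leRHS](mean_cst X); apply: mean_le => //; first exact: cont_cst.
by rewrite -[leLHS]mulr1 expr2 ler_pM2l.
Qed.

Lemma idempotent_diff p q : convol_idempotent p -> convol_idempotent q ->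
  convol p q = q -> q <> p -> convol_idempotent (fun x => p x - q x).
Proof.
move=> [cp sp _ pp mp] [cq sq _ qq mq] pq qnp.
have cd : continuous (fun x => p x - q x) by cts.
have cN : continuous (fun x => -1 * q x) by exact: contZ.
have E : (fun x => p x - q x) = (fun x => p x + -1 * q x).
  by apply/funext => x; rewrite mulN1r.
have qp : convol q p = q by rewrite convolC.
have Dp : convol p (fun x => p x - q x) = (fun x => p x - q x).
  by rewrite {1}E convolD// convolZr// pp pq E.
have Dq : convol q (fun x => p x - q x) = (fun=> 0).
  by rewrite {1}E convolD// convolZr// qp qq; apply/funext => x; rewrite mulN1r subrr.
split => //.
- by move=> x; rewrite sp sq.
- apply: contrapT => /forallNP H; apply: qnp; apply/funext => x; apply/eqP.
  by rewrite eq_sym -subr_eq0; have /negP := H x; rewrite negbK.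
- rewrite {2}E convolD// convolZr//.
  rewrite (convolC _ cd cp)// (convolC _ cd cq)// Dp Dq.
  by apply/funext => x; rewrite mulr0 addr0.
- by rewrite meanB// mp mq subrr.
Qed.

Lemma idempotent_of k : continuous k -> (forall x, k (- x) = k x) ->
  (exists x, k x != 0) -> mean k = 0 -> exists q c,
  [/\ convol_idempotent q, convol (convol k k) q = (fun x => c * q x) &
    forall f, continuous f -> convol f k = k -> convol f q = q].
Proof.
move=> ck sk kn0 mk.
have [q [c [cq sq qn0 qq [c0 kkq H]]]] := idempotent_exists compactX ck sk kn0.
exists q, c; split => //.
  split => //.
  have := H (fun=> 1) 0 (@cont_cst _ _ 1).
  have c1 (f : X -> R) : convol (fun=> 1) f = (fun=> mean f).
    by apply/funext => x; congr mean; apply/funext => y; rewrite mul1r.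
  rewrite !c1 mk.
  have z (f : X -> R) : (fun x => 0 * f x) = (fun=> 0).
    by apply/funext => x; rewrite mul0r.
  by rewrite !z => /(_ erefl) /(congr1 (fun f => f 0)).
move=> f cf fk; have := H f 1 cf; rewrite fk.
have o (g : X -> R) : (fun x => 1 * g x) = g by apply/funext => x; rewrite mul1r.
by rewrite !o; exact.
Qed.

Hypothesis hausdorffX : hausdorff_space X.
Hypothesis nontrivX : exists z : X, z != 0.

Lemma convol_idempotent_exists : exists p, convol_idempotent p.
Proof.
have [z z0] := nontrivX.
have := @normal_separatorP R X; case=> /(_ (compact_normal hausdorffX compactX)) H _.
have cl1 (t : X) : closed [set t].
  exact: accessible_closed_set1 (hausdorff_accessible hausdorffX) t.
have := H [set 0] [set z] (cl1 0) (cl1 z).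
have -> : [set 0] `&` [set z] = set0.
  by rewrite -subset0 => x [/= -> /esym/eqP]; rewrite (negPf z0).
move=> /(_ erefl) /(@uniform_separatorP _ R) [g [cg g01 g0 g1]].
pose k0 (x : X) : R := g x + g (- x).
have ck0 : continuous k0 by rewrite /k0; cts.
pose k x := k0 x - mean k0.
have ck : continuous k by apply: contB => //; exact: cont_cst.
have [||||q [c [qi _ _]]] := @idempotent_of k; last by exists q.
- exact: ck.
- by move=> x; rewrite /k /k0 opprK addrC [g x + _]addrC addrC.
- apply: contrapT => /forallNP K.
  have e0 : g 0 = 0 by apply: g0; exists 0.
  have e1 : g z = 1 by apply: g1; exists z.
  have := K 0; have := K z; rewrite /k /k0 oppr0 e0 e1 => /negP; rewrite negbK => /eqP A.
  move=> /negP; rewrite negbK => /eqP B.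
  have := g01 (g (- z)) (ex_intro2 _ _ _ I erefl); rewrite /= in_itv /= => /andP[C _].
  lra.
- by rewrite meanB ?mean_cst ?subrr//; exact: cont_cst.
Qed.

(** If [q] is a proper part of [p], then [p 0 = q 0 + (p - q) 0] is at least
    twice the infimum of the values at 0, hence at least the infimum plus 1;
    this fails once [p 0] is within 1 of the infimum. *)
Lemma minimal_idempotent : exists2 p, convol_idempotent p &
  forall q, convol_idempotent q -> convol p q = q -> q = p.
Proof.
pose S : set R := [set p 0 | p in convol_idempotent].
have iS : has_inf S.
  split; first by have [p pi] := convol_idempotent_exists; exists (p 0), p.
  by exists 1 => _ [p /idempotent_ge1 p1 <-].
have S1 : 1 <= inf S.
  by apply: lb_le_inf iS.1 _ => _ [p /idempotent_ge1 p1 <-].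
have [_ [p pi <-] plt] := inf_adherent ltr01 iS.
exists p => // q qi pq; apply: contrapT => qnp.
have di := idempotent_diff pi qi pq qnp.
have H1 : inf S <= q 0 by apply: ge_inf iS.2 _ _; exists q.
have H2 : inf S <= p 0 - q 0 by apply: ge_inf iS.2 _ _; exists (fun x => p x - q x).
lra.
Qed.

(** Every symmetric [k] in the ideal of a minimal idempotent [p] has a square
    proportional to [p].  Applied to the symmetrised translate
    [k x = p (x + y) + p (x - y)] and to [k + p], whose squares differ by
    [2 k + p], it shows that [k] itself is proportional to [p]. *)
Lemma dalembert_exists : exists C : X -> R, [/\ continuous C, C 0 = 1, mean C = 0 &
  forall x y, C (x + y) + C (x - y) = 2 * C x * C y].
Proof.
have [p pidem pmin] := minimal_idempotent.
have p1 := idempotent_ge1 pidem.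
have [cp sp pn0 pp mp] := pidem.
have sq k : continuous k -> (forall x, k (- x) = k x) -> convol p k = k ->
    exists c, convol k k = (fun x => c * p x).
  move=> ck sk pk.
  have [kn0|k0] := pselect (exists x, k x != 0); last first.
    have -> : k = (fun=> 0).
      apply/funext => x; apply/eqP; apply: contrapT => /negP kx.
      by apply: k0; exists x.
    exists 0; apply/funext => x; rewrite mul0r /convol.
    by under eq_fun do rewrite mulr0; rewrite mean_cst.
  have mk : mean k = 0.
    have c1 (f : X -> R) x : convol (fun=> 1) f x = mean f.
      by congr mean; apply/funext => y; rewrite mul1r.
    rewrite -(c1 k 0) -pk convolA//; last exact: cont_cst.
    have -> : convol (fun=> 1) p = (fun=> 0) by apply/funext => x; rewrite c1 mp.
    rewrite /convol; under eq_fun do rewrite mul0r.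
    by rewrite mean_cst.
  have [q [c [qi kkq H]]] := idempotent_of ck sk kn0 mk.
  have qp : q = p by apply: pmin => //; exact: H.
  exists c; rewrite -qp -kkq qp.
  by rewrite -convolA// (convolC _ ck cp)// pk.
have key y : exists c, forall x, p (x + y) + p (x - y) = c * p x.
  pose k x := p (x + y) + p (x - y).
  have cpl : continuous (fun x => p (x + y)) by cts.
  have cpr : continuous (fun x => p (x - y)) by exact: cont_addr.
  have ck : continuous k by exact: contD.
  have sk x : k (- x) = k x.
    by rewrite /k -sp -[p (- x - y)]sp !opprD !opprK addrC.
  have pk : convol p k = k.
    by rewrite /k convolD// !convol_shift// pp.
  have ck2 : continuous (fun x => k x + p x) by exact: contD.
  have [c0 kk] := sq k ck sk pk.
  have [||c1 kk2] := sq (fun x => k x + p x) ck2.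
  - by move=> x; rewrite sk sp.
  - by rewrite convolD// pk pp.
  exists ((c1 - c0 - 1) / 2) => x; rewrite -/(k x).
  have kp : convol k p = k by rewrite convolC.
  have : convol (fun x => k x + p x) (fun x => k x + p x) x =
     (c0 * p x + k x) + (k x + p x).
    have E1 : convol k (fun x => k x + p x) = (fun x => c0 * p x + k x).
      by rewrite convolD// kk kp.
    have E2 : convol p (fun x => k x + p x) = (fun x => k x + p x).
      by rewrite convolD// pk pp.
    by rewrite convolD// (convolC _ ck2 ck)// (convolC _ ck2 cp)// E1 E2.
  rewrite kk2; lra.
exists (fun x => p x / p 0).
have p0 : p 0 != 0 by rewrite gt_eqF// (lt_le_trans ltr01).
split.
- by under eq_fun do rewrite mulrC; exact: contZ.
- by rewrite divff.
- under eq_fun do rewrite mulrC.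
  by rewrite meanZ// mp mulr0.
move=> x y; have [c Hc] := key y.
have := Hc 0; rewrite add0r sub0r sp => E0.
have -> : p y = c * p 0 / 2 by rewrite -E0; lra.
by rewrite -mulrDl Hc; field.
Qed.

End MinimalIdempotent.

(** * Cosine and sine measured in turns *)

Section Turns.
Variable R : realType.
Implicit Types u v e : R.

Definition cosT u : R := cos (u * (pi *+ 2)).
Definition sinT u : R := sin (u * (pi *+ 2)).

Lemma cosT0 : cosT 0 = 1. Proof. by rewrite /cosT mul0r cos0. Qed.
Lemma cosTN u : cosT (- u) = cosT u. Proof. by rewrite /cosT mulNr cosN. Qed.
Lemma sinTN u : sinT (- u) = - sinT u. Proof. by rewrite /sinT mulNr sinN. Qed.
Lemma cosTD u v : cosT (u + v) = cosT u * cosT v - sinT u * sinT v.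
Proof. by rewrite /cosT /sinT mulrDl cosD. Qed.
Lemma sinTD u v : sinT (u + v) = sinT u * cosT v + cosT u * sinT v.
Proof. by rewrite /cosT /sinT mulrDl sinD. Qed.
Lemma cosTB u v : cosT (u - v) = cosT u * cosT v + sinT u * sinT v.
Proof. by rewrite cosTD cosTN sinTN mulrN opprK. Qed.
Lemma cosT2DsinT2 u : cosT u ^+ 2 + sinT u ^+ 2 = 1.
Proof. by rewrite /cosT /sinT cos2Dsin2. Qed.
Lemma cosT_le1 u : cosT u <= 1. Proof. exact: cos_le1. Qed.
Lemma cosT_geN1 u : -1 <= cosT u. Proof. exact: cos_geN1. Qed.

Lemma cosT_int u : u \is a Num.int -> cosT u = 1.
Proof.
move=> /intrP[z ->].
wlog [n ->] : z / exists n : nat, z = n.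
  move=> H; case: z => n; first by apply: H; exists n.
  by rewrite NegzE mulrNz cosTN; apply: H; exists n.+1.
elim: n => [|n IH]; first by rewrite cosT0.
have c1 : cosT 1 = 1 by rewrite /cosT mul1r cos2pi.
have s1 : sinT 1 = 0 by rewrite /sinT mul1r sin2pi.
by rewrite -addn1 PoszD intrD cosTD IH c1 s1 mulr0 subr0 mulr1.
Qed.

Lemma sinT_int u : u \is a Num.int -> sinT u = 0.
Proof.
move=> /cosT_int h; have := cosT2DsinT2 u; rewrite h expr1n => /eqP.
by rewrite -subr_eq0 addrAC subrr add0r sqrf_eq0 => /eqP.
Qed.

Lemma cosTD_int u v : v \is a Num.int -> cosT (u + v) = cosT u.
Proof. by move=> vi; rewrite cosTD (cosT_int vi) (sinT_int vi) mulr1 mulr0 subr0. Qed.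

Lemma sinTD_int u v : v \is a Num.int -> sinT (u + v) = sinT u.
Proof. by move=> vi; rewrite sinTD (cosT_int vi) (sinT_int vi) mulr1 mulr0 addr0. Qed.

(** The representative of [u] modulo 1 nearest to 0 is [u - nearest_int u]. *)
Definition nearest_int u : R := (Num.floor (u + 1 / 2))%:~R.

Lemma nearest_int_int u : nearest_int u \is a Num.int.
Proof. by rewrite /nearest_int intr_int. Qed.

Lemma nearest_int_half u : `|u - nearest_int u| <= 1 / 2.
Proof.
rewrite /nearest_int; have := floor_itv (u + 1 / 2); rewrite intrD => /andP[H1 H2].
by rewrite ler_distl; apply/andP; split; lra.
Qed.

Lemma cosT_nearest_int u : cosT (u - nearest_int u) = cosT u.
Proof. by rewrite cosTD_int// rpredN nearest_int_int. Qed.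

Lemma lt_nearest_int u e : 0 < e -> e <= 1 / 2 -> cosT e < cosT u ->
  `|u - nearest_int u| < e.
Proof.
move=> e0 e2; rewrite -(cosT_nearest_int u).
have := nearest_int_half u; move: (u - nearest_int u) => w.
have -> : cosT w = cosT `|w| by case: (ger0P w) => // _; rewrite cosTN.
have := normr_ge0 w; move: `|w| => {}w w0 w2.
have p2 : 0 < pi *+ 2 :> R by rewrite mulrn_wgt0// pi_gt0.
have I (x : R) : 0 <= x -> x <= 1 / 2 -> x * (pi *+ 2) \in `[0, pi].
  move=> x0 x2; rewrite in_itv /=; apply/andP; split; first by rewrite mulr_ge0// ltW.
  have := @pi_gt0 R; rewrite mulr2n => ?; nra.
have Ie := I e (ltW e0) e2; have Iw := I w w0 w2.
by rewrite /cosT ltr_cos// ltr_pM2r.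
Qed.

Lemma cosT_lt1 e : 0 < e -> e <= 1 / 2 -> cosT e < 1.
Proof.
move=> e0 e2; rewrite -[ltRHS]cosT0.
have p2 : 0 < pi *+ 2 :> R by rewrite mulrn_wgt0// pi_gt0.
rewrite /cosT ltr_cos ?ltr_pM2r// in_itv /=.
  by rewrite mul0r lexx pi_ge0.
apply/andP; split; first by rewrite mulr_ge0// ltW.
have := @pi_gt0 R; rewrite mulr2n => ?; nra.
Qed.

Lemma cosT_eq1 u : cosT u = 1 -> u \is a Num.int.
Proof.
move=> u1; suff -> : u = nearest_int u by exact: nearest_int_int.
apply/eqP; rewrite -subr_eq0 -normr_eq0 eq_le normr_ge0 andbT.
rewrite leNgt; apply/negP => H.
have := @lt_nearest_int u _ H (nearest_int_half u).
rewrite u1 => /(_ (cosT_lt1 H (nearest_int_half u))).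
by rewrite ltxx.
Qed.

Lemma angle_exists (c s : R) : c ^+ 2 + s ^+ 2 = 1 -> exists u, cosT u = c /\ sinT u = s.
Proof.
move=> cs1; have c1 : -1 <= c <= 1.
  by have := sqr_ge0 s; rewrite !expr2 in cs1 * => h; apply/andP; split; nra.
have p2 : pi *+ 2 != 0 :> R by rewrite mulrn_eq0 negb_or /= gt_eqF// pi_gt0.
have E : Num.sqrt (1 - c ^+ 2) = `|s| by rewrite -cs1 addrAC subrr add0r sqrtr_sqr.
have ca : cos (acos c) = c by apply: acosK; rewrite in_itv.
have [s0|s0] := leP 0 s.
  exists (acos c / (pi *+ 2)); rewrite /cosT /sinT divfK// ca; split => //.
  by rewrite sin_acos// E ger0_norm.
exists (- acos c / (pi *+ 2)); rewrite /cosT /sinT divfK// cosN ca; split => //.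
by rewrite sinN sin_acos// E ltr0_norm ?opprK.
Qed.

End Turns.

(** * Characters of a compact connected group *)

Section Characters.
Variables (R : realType) (X : topologicalZmodType).
Implicit Types (s t : X -> R).

(** [s] is a lift to R of a continuous character with values in R/Z; the lift
    itself need not be continuous, only its cosine and sine are. *)
Definition character s := [/\ forall x y, s (x + y) - s x - s y \is a Num.int,
  continuous (fun x => cosT (s x)) & continuous (fun x => sinT (s x))].

Lemma characterD s t : character s -> character t -> character (fun x => s x + t x).
Proof.
move=> [si cs1 cs2] [ti ct1 ct2]; split.
- move=> x y; rewrite (_ : _ - _ - _ =
    (s (x + y) - s x - s y) + (t (x + y) - t x - t y)); last by ring.
  by rewrite rpredD.
- by under eq_fun do rewrite cosTD; apply: contB; exact: contM.
- by under eq_fun do rewrite sinTD; apply: contD; exact: contM.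
Qed.

Lemma character0 : character (fun=> 0).
Proof.
split; first by move=> x y; rewrite !subr0 rpred0.
- exact: (@cont_cst R X (cosT 0)).
- exact: (@cont_cst R X (sinT 0)).
Qed.

Lemma characterN s : character s -> character (fun x => - s x).
Proof.
move=> [si cs1 cs2]; split.
- move=> x y; rewrite (_ : _ - _ - _ = - (s (x + y) - s x - s y)); last by ring.
  by rewrite rpredN.
- by under eq_fun do rewrite cosTN.
- under eq_fun do rewrite sinTN -mulN1r; exact: contZ.
Qed.

Lemma characterZ s (z : int) : character s -> character (fun x => z%:~R * s x).
Proof.
move=> cs_; have nat_case (n : nat) : character (fun x => n%:R * s x).
  elim: n => [|n IH]; first by under eq_fun do rewrite mul0r; exact: character0.
  under eq_fun do rewrite -natr1 mulrDl mul1r.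
  exact: characterD.
case: z => n; first exact: nat_case.
under eq_fun do rewrite NegzE mulrNz mulNr.
exact: (characterN (nat_case n.+1)).
Qed.

Lemma character_sum (I : Type) (r : seq I) (F : I -> X -> R) :
  (forall i, character (F i)) -> character (fun x => \sum_(i <- r) F i x).
Proof.
move=> cF; elim: r => [|i r IH].
  by under eq_fun do rewrite big_nil; exact: character0.
by under eq_fun do rewrite big_cons; exact: characterD.
Qed.

Lemma character_comp s (f : X -> X) : {morph f : x y / x + y} -> continuous f ->
  character s -> character (fun x => s (f x)).
Proof.
move=> fD cf [si c1 c2]; split.
- by move=> x y; rewrite fD.
- by move=> x; apply: (@continuous_comp _ _ _ f (fun y => cosT (s y))); [exact: cf|exact: c1].
- by move=> x; apply: (@continuous_comp _ _ _ f (fun y => sinT (s y))); [exact: cf|exact: c2].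
Qed.

Lemma character_at0 s : character s -> s 0 \is a Num.int.
Proof. by move=> [/(_ 0 0) + _ _]; rewrite addr0 subrr sub0r rpredN. Qed.

Lemma character_int_add s x y : character s -> s x \is a Num.int -> s y \is a Num.int ->
  s (x + y) \is a Num.int.
Proof.
move=> [si _ _] sx sy; have := si x y.
by rewrite -addrA -opprD => H; rewrite -[s (x + y)](subrK (s x + s y)) rpredD// rpredD.
Qed.

Lemma character_int_sub s x y : character s -> s x \is a Num.int -> s y \is a Num.int ->
  s (x - y) \is a Num.int.
Proof.
move=> cs_ sx sy; apply: character_int_add => //.
have [/(_ (- y) y) + _ _] := cs_; rewrite addNr => H.
have -> : s (- y) = s 0 - s y - (s 0 - s (- y) - s y) by ring.
by rewrite rpredB// rpredB// character_at0.
Qed.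

Lemma character_near0 s e : character s -> 0 < e ->
  \forall v \near (0 : X), `|s v - nearest_int (s v)| < e.
Proof.
move=> cs_; wlog e2 : e / e <= 1 / 2.
  move=> H e0; have [e2|e2] := leP e (1 / 2); first exact: H.
  have : \forall v \near (0 : X), `|s v - nearest_int (s v)| < 1 / 2 by apply: H => //; lra.
  by apply: filterS => v /lt_trans; apply.
move=> e0; have [_ c1 _] := cs_.
have H1 : cosT (s 0) = 1 by apply: cosT_int; exact: character_at0.
have /cvgrPdist_lt := c1 0.
have d0 : 0 < 1 - cosT e by rewrite subr_gt0 cosT_lt1.
move=> /(_ _ d0); apply: filterS => v; rewrite H1 => H.
apply: lt_nearest_int => //; move: H; rewrite ltr_norml => /andP[_]; lra.
Qed.

Lemma character_kernel_closed s : character s -> closed [set x | s x \is a Num.int].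
Proof.
move=> [_ c1 _].
have -> : [set x | s x \is a Num.int] = (fun x => cosT (s x)) @^-1` [set y | y = 1].
  by apply/seteqP; split => x /=; [exact: cosT_int|exact: cosT_eq1].
by apply: preimage_closed => [x _|]; [exact: c1|exact: closed_eq].
Qed.

Hypothesis connectedX : connected [set: X].

Lemma clopen_full (A : set X) x0 : open A -> closed A -> A x0 -> forall x, A x.
Proof.
move=> oA cA Ax x; suff -> : A = [set: X] by [].
by apply: connectedX; [exists x0|exists A; rewrite ?setTI|exists A; rewrite ?setTI].
Qed.

(** The set where [s] is integral is closed; it is also open, since near 0
    the number [s v] is within [1 / |z|] of an integer and [z * s v] is
    integral. *)
Lemma character_torsion s (z : int) : character s -> z != 0 ->
  (forall x, z%:~R * s x \is a Num.int) -> forall x, s x \is a Num.int.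
Proof.
move=> cs_ z0 H.
have zn : 0 < `|z%:~R| :> R by rewrite normr_gt0 intr_eq0.
apply: (@clopen_full [set x | s x \is a Num.int] 0) => /=; last 2 first.
- exact: character_kernel_closed.
- exact: character_at0.
rewrite openE => x /= sx.
apply: (@nbhs_translate _ x (fun y => s y \is a Num.int)).
have := character_near0 cs_ (divr_gt0 ltr01 zn).
apply: filterS => v Hv; apply: character_int_add => //.
have : z%:~R * (s v - nearest_int (s v)) \is a Num.int.
  by rewrite mulrBr rpredB// rpredM ?nearest_int_int ?intr_int.
move=> /intrP[m Hm].
have : `|z%:~R * (s v - nearest_int (s v))| < 1.
  by rewrite normrM mulrC -ltr_pdivlMr.
rewrite Hm -intr_norm (ltr_int _ _ 1) => m1.
have m0 : m = 0 by lia.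
move/eqP: Hm; rewrite m0 mulf_eq0 intr_eq0 (negPf z0) /= subr_eq0 => /eqP ->.
exact: nearest_int_int.
Qed.

Lemma character_scale_nontrivial s (z : int) : character s -> z != 0 ->
  (exists x, s x \isn't a Num.int) -> exists x, z%:~R * s x \isn't a Num.int.
Proof.
move=> cs_ z0 [x sx]; apply: contrapT => /forallNP H.
move: sx; rewrite (character_torsion cs_ z0)// => y.
by have /negP := H y; rewrite negbK.
Qed.

Hypothesis compactX : compact [set: X].
Hypothesis hausdorffX : hausdorff_space X.
Hypothesis nontrivX : exists z : X, z != 0.

(** Let [C] solve the cosine equation with mean 0.  By connectedness [C]
    vanishes at some [z], a quarter turn, so [S x := C (x - z)] is the sine that
    goes with the cosine [C], and the addition formulas follow from the cosine
    equation alone. *)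
Lemma character_exists : exists2 t, character t & exists x, t x \isn't a Num.int.
Proof.
have [C [cC C0 mC HC]] := dalembert_exists R compactX hausdorffX nontrivX.
have [z Cz] : exists z, C z = 0.
  apply: contrapT => /forallNP Cn0.
  have Cpos : forall x, 0 < C x.
    apply: (@clopen_full [set x | 0 < C x] 0) => /=; last by rewrite C0.
      by apply: (@open_comp _ _ C [set y | 0 < y]) => [x _|]; [exact: cC|exact: open_gt].
    have -> : [set x | 0 < C x] = C @^-1` [set y | 0 <= y].
      apply/seteqP; split => x /= h; first exact: ltW.
      by rewrite lt_neqAle h eq_sym andbT; apply/eqP/Cn0.
    by apply: preimage_closed => [x _|]; [exact: cC|exact: closed_ge].
  have : 0 < mean C.
    apply: mean_gt0 => //; first by move=> x; exact: ltW.
    by exists 0; rewrite C0 oner_eq0.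
  by rewrite mC ltxx.
have Cev x : C (- x) = C x.
  have := HC 0 x; rewrite C0 add0r sub0r mulr1; lra.
pose S x := C (x - z).
have Cz2 x : C (x - z - z) = - C x.
  by have := HC (x - z) z; rewrite subrK Cz mulr0; lra.
have Cadd x y : C (x + y) = C x * C y - S x * S y.
  have := HC x y; have := HC (x - z) (y - z).
  have -> : x - z - (y - z) = x - y by rewrite opprB addrA subrK.
  have -> : x - z + (y - z) = x + y - z - z by rewrite addrACA addrA.
  by rewrite Cz2 /S; lra.
have Sadd x y : S (x + y) = S x * C y + C x * S y.
  have := HC (x - z) y; have := HC x (y - z); rewrite /S.
  have -> : x + (y - z) = x + y - z by rewrite addrA.
  have -> : x - z + y = x + y - z by rewrite addrAC.
  have -> : x - (y - z) = x - y + z by rewrite opprB addrA addrAC.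
  have -> : x - z - y = x - y - z by rewrite addrAC.
  have := HC (x - y) z; rewrite Cz mulr0; lra.
have CS x : C x ^+ 2 + S x ^+ 2 = 1.
  have := Cadd x (- x); rewrite subrr C0 Cev.
  have -> : S (- x) = - S x.
    by have := HC x z; rewrite Cz mulr0 /S -[C (- x - z)]Cev opprD !opprK; lra.
  by rewrite mulrN opprK !expr2 => ->.
have cS : continuous S by exact: cont_addr.
have ang x := angle_exists (CS x).
have [t Ht] := choice ang.
exists t; first split.
- move=> x y; apply: cosT_eq1; rewrite -addrA -opprD cosTB cosTD sinTD.
  have [-> ->] := Ht x; have [-> ->] := Ht y; have [-> ->] := Ht (x + y).
  by rewrite -(CS (x + y)) !expr2; congr (_ * _ + _ * _); [rewrite Cadd|rewrite Sadd].
- by under eq_fun do rewrite (Ht _).1.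
- by under eq_fun do rewrite (Ht _).2.
exists z; apply/negP => /cosT_int; rewrite (Ht z).1 Cz => /eqP.
by rewrite eq_sym oner_eq0.
Qed.

End Characters.

(** * Kronecker approximation by Riesz products *)

Section Kronecker.
Variables (R : realType) (X : topologicalZmodType).
Hypothesis compactX : compact [set: X].

(** Translation by [y] multiplies the mean of a character by its value at [y],
    which is different from 1 for a suitable [y]. *)
Lemma mean_character (s : X -> R) (u : R) :
  character s -> (exists x, s x \isn't a Num.int) ->
  mean (fun x => cosT (s x + u)) = 0.
Proof.
move=> [si c1 c2] [y sy].
set A := mean (fun x => cosT (s x)); set B := mean (fun x => sinT (s x)).
have addE x : exists2 z, z \is a Num.int & s (x + y) = s x + s y + z.
  by exists (s (x + y) - s x - s y) => //; ring.
have HA : A = cosT (s y) * A - sinT (s y) * B.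
  rewrite {1}/A -(mean_shift compactX y c1).
  have -> : (fun x => cosT (s (x + y))) =
      (fun x => cosT (s y) * cosT (s x) - sinT (s y) * sinT (s x)).
    apply/funext => x; have [z zi ->] := addE x.
    by rewrite cosTD_int// cosTD mulrC [sinT _ * _]mulrC.
  by rewrite meanB ?meanZ//; exact: contZ.
have HB : B = cosT (s y) * B + sinT (s y) * A.
  rewrite {1}/B -(mean_shift compactX y c2).
  have -> : (fun x => sinT (s (x + y))) =
      (fun x => cosT (s y) * sinT (s x) + sinT (s y) * cosT (s x)).
    apply/funext => x; have [z zi ->] := addE x.
    by rewrite sinTD_int// sinTD mulrC [sinT (s y) * _]mulrC.
  by rewrite meanD ?meanZ//; exact: contZ.
have cn1 : 1 - cosT (s y) != 0.
  by rewrite subr_eq0 eq_sym; apply: contra sy => /eqP /cosT_eq1.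
have E0 : (1 - cosT (s y)) * (A * A + B * B) = 0.
  have E1 : (1 - cosT (s y)) * (A * A + B * B) =
     A * (A - cosT (s y) * A) + B * (B - cosT (s y) * B) by ring.
  have HA' : A - cosT (s y) * A = - (sinT (s y) * B) by lra.
  have HB' : B - cosT (s y) * B = sinT (s y) * A by lra.
  by rewrite E1 HA' HB'; ring.
have [A0 B0] : A = 0 /\ B = 0.
  move/eqP: E0; rewrite mulf_eq0 (negPf cn1) /= -!expr2.
  rewrite paddr_eq0 ?sqr_ge0// !sqrf_eq0 => /andP[/eqP -> /eqP ->].
  by [].
have -> : (fun x => cosT (s x + u)) = (fun x => cosT u * cosT (s x) - sinT u * sinT (s x)).
  by apply/funext => x; rewrite cosTD mulrC [sinT _ * _]mulrC.
by rewrite meanB ?meanZ// -/A -/B ?A0 ?B0 ?mulr0 ?subr0//; exact: contZ.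
Qed.

Variables (K : nat) (t : nat -> X -> R) (e : nat -> R).
Hypothesis tchar : forall i, character (t i).
Hypothesis indep : forall c : nat -> int, (exists2 i, (i < K)%N & c i != 0) ->
  exists x, \sum_(i < K) (c i)%:~R * t i x \isn't a Num.int.
Implicit Types (c d : nat -> int) (ds : seq (nat -> int)).

Definition phase c x := \sum_(i < K) (c i)%:~R * (t i x - e i).
Definition wave c x := cosT (phase c x).
Definition riesz ds x := \prod_(d <- ds) (1 + wave d x).

Lemma wave_cont c : continuous (wave c).
Proof.
have [_ c1 c2] : character (fun x => \sum_(i < K) (c i)%:~R * t i x).
  by apply: character_sum => i; exact: characterZ.
pose u : R := \sum_(i < K) (c i)%:~R * e i.
have -> : wave c = (fun x => cosT u * cosT (\sum_(i < K) (c i)%:~R * t i x) +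
    sinT u * sinT (\sum_(i < K) (c i)%:~R * t i x)).
  apply/funext => x; rewrite /wave /phase.
  by under eq_bigr do rewrite mulrBr; rewrite sumrB cosTB mulrC [sinT u * _]mulrC.
by apply: contD; exact: contZ.
Qed.

Lemma mean_wave c : (exists2 i, (i < K)%N & c i != 0) -> mean (wave c) = 0.
Proof.
move=> cn0; rewrite -(@mean_character (fun x => \sum_(i < K) (c i)%:~R * t i x)
  (- \sum_(i < K) (c i)%:~R * e i)).
- congr mean; apply/funext => x; rewrite /wave /phase -sumrB.
  by under eq_bigr do rewrite mulrBr.
- by apply: character_sum => i; exact: characterZ.
- exact: indep.
Qed.

Lemma waveM c d x : wave c x * wave d x =
  2^-1 * (wave (fun i => c i + d i) x + wave (fun i => c i - d i) x).
Proof.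
have pD : phase (fun i => c i + d i) x = phase c x + phase d x.
  by rewrite /phase -big_split; apply: eq_bigr => i _; rewrite /= intrD mulrDl.
have pB : phase (fun i => c i - d i) x = phase c x - phase d x.
  by rewrite /phase -sumrB; apply: eq_bigr => i _; rewrite /= intrB mulrBl.
by rewrite /wave pD pB cosTD cosTB; field.
Qed.

Lemma riesz_cons d ds x : riesz (d :: ds) x = riesz ds x + wave d x * riesz ds x.
Proof. by rewrite /riesz big_cons mulrDl mul1r. Qed.

Lemma riesz_cont ds : continuous (riesz ds).
Proof.
elim: ds => [|d ds IH].
  have -> : riesz [::] = (fun=> 1) by apply/funext => x; rewrite /riesz big_nil.
  exact: cont_cst.
have -> : riesz (d :: ds) = (fun x => riesz ds x + wave d x * riesz ds x).
  by apply/funext => x; exact: riesz_cons.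
apply: contD => //.
by apply: contM => //; exact: wave_cont.
Qed.

(** No combination of [c] with coefficients -1, 0, 1 of the members of [ds] is
    the trivial frequency. *)
Fixpoint avoids ds c : Prop :=
  if ds is d :: ds' then
    [/\ avoids ds' c, avoids ds' (fun i => c i + d i) & avoids ds' (fun i => c i - d i)]
  else exists2 i, (i < K)%N & c i != 0.

(** Expanding the Riesz product of a dissociated list yields 1 plus waves of
    nontrivial frequency, so its mean is 1. *)
Fixpoint dissociated ds : Prop :=
  if ds is d :: ds' then avoids ds' d /\ dissociated ds' else True.

Lemma mean_wave_riesz ds c : avoids ds c -> mean (fun x => wave c x * riesz ds x) = 0.
Proof.
elim: ds c => [|d ds IH] c /=.
  move=> /mean_wave <-; congr mean; apply/funext => x.
  by rewrite /riesz big_nil mulr1.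
move=> [H1 H2 H3].
have cw i := @wave_cont i; have cr := @riesz_cont ds.
have cwr i : continuous (fun x => wave i x * riesz ds x) by exact: contM.
have -> : (fun x => wave c x * riesz (d :: ds) x) = (fun x => wave c x * riesz ds x +
   2^-1 * (wave (fun i => c i + d i) x * riesz ds x +
           wave (fun i => c i - d i) x * riesz ds x)).
  by apply/funext => x; rewrite riesz_cons mulrDr mulrA waveM -mulrA mulrDl.
rewrite meanD//; last by apply: contZ; exact: contD.
rewrite meanZ; [|by []|exact: contD].
by rewrite (meanD compactX (cwr _) (cwr _)) (IH _ H1) (IH _ H2) (IH _ H3) addr0 mulr0 addr0.
Qed.

Lemma mean_riesz ds : dissociated ds -> mean (riesz ds) = 1.
Proof.
elim: ds => [_|d ds IH /= [H1 H2]].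
  have -> : riesz [::] = (fun=> 1) by apply/funext => x; rewrite /riesz big_nil.
  exact: mean_cst.
have cw i := @wave_cont i; have cr := @riesz_cont ds.
have -> : riesz (d :: ds) = (fun x => riesz ds x + wave d x * riesz ds x).
  by apply/funext => x; exact: riesz_cons.
by rewrite meanD ?IH ?mean_wave_riesz ?addr0//; exact: contM.
Qed.

(** Divisibility of one coordinate by [m] is a certificate: combinations of
    [ds] cannot change the class of [c i] modulo [m]. *)
Lemma avoids_dvd ds c i (m : int) : (i < K)%N -> ~~ (m %| c i)%Z ->
  (forall d, List.In d ds -> (m %| d i)%Z) -> avoids ds c.
Proof.
move=> iK; elim: ds c => [|d ds IH] c mc H /=.
  by exists i => //; apply: contraNneq mc => ->; rewrite dvdz0.
have md : (m %| d i)%Z by apply: H; left.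
have H' d' : List.In d' ds -> (m %| d' i)%Z by move=> h; apply: H; right.
split; apply: IH => //.
  by rewrite rpredDr.
by rewrite rpredBr.
Qed.

Definition dyadic (j i : nat) : nat -> int := fun i' => if i' == i then (2 ^ j)%N%:Z else 0.

Lemma phase_dyadic j i x : (i < K)%N -> phase (dyadic j i) x = (2 ^+ j) * (t i x - e i).
Proof.
move=> iK; rewrite /phase (bigD1 (Ordinal iK))//= big1 ?addr0.
  by rewrite /dyadic eqxx -pmulrn natrX.
by move=> k; rewrite -val_eqE /= => /negPf kn; rewrite /dyadic kn mul0r.
Qed.

Definition dyadics N (I : seq nat) :=
  flatten [seq [seq dyadic j i | j <- iota 0 N] | i <- I].

Lemma dyadics_off N I i d : i \notin I -> List.In d (dyadics N I) -> d i = 0.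
Proof.
elim: I => //= k I IH; rewrite in_cons negb_or => /andP[ik iI].
rewrite /dyadics /= => /List.in_app_iff [|]; last exact: IH.
elim: (iota 0 N) => //= j s IHs [<-|]; last exact: IHs.
by rewrite /dyadic (negPf ik).
Qed.

(** In one direction, [2 ^ r.+1] divides the powers of 2 that follow [2 ^ r] but
    not [2 ^ r] itself. *)
Lemma dissociated_block N r i ds : (i < K)%N -> dissociated ds ->
  (forall d, List.In d ds -> d i = 0) ->
  dissociated ([seq dyadic j i | j <- iota r N] ++ ds).
Proof.
move=> iK dds dsi; elim: N r => //= N IH r; split => //.
apply: (@avoids_dvd _ _ i (2 ^ r.+1)%N) => //.
  by rewrite /dyadic eqxx dvdzE /= dvdn_Pexp2l// ltnn.
move=> d /List.in_app_iff [|/dsi ->]; last by rewrite dvdz0.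
have H n k l : (l <= k)%N -> List.In d [seq dyadic j i | j <- iota k n] ->
    ((2 ^ l)%N %| d i)%Z.
  elim: n k => //= n IHn k lk [<-|]; last by apply: IHn; exact: leqW.
  by rewrite /dyadic eqxx dvdzE /= dvdn_Pexp2l.
exact: H.
Qed.

Lemma dyadics_dissociated N I : uniq I -> (forall i, i \in I -> (i < K)%N) ->
  dissociated (dyadics N I).
Proof.
elim: I => //= i I IH /andP[iI uI] IK.
apply: dissociated_block; first by apply: IK; rewrite mem_head.
  by apply: IH => // k kI; apply: IK; rewrite in_cons kI orbT.
by move=> d; exact: dyadics_off.
Qed.

(** The product telescopes through (1 - c) (1 + c) = (1 - c') / 2, where [c']
    is the cosine of the doubled angle; this is the Fejer kernel of order
    [2 ^ N]. *)
Lemma fejer_bound N (u : R) :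
  (1 - cosT u) * \prod_(j <- iota 0 N) (1 + cosT (2 ^+ j * u)) =
  (1 - cosT (2 ^+ N * u)) / 2 ^+ N.
Proof.
elim: N => [|N IH]; first by rewrite big_nil !expr0 mul1r mulr1 divr1.
rewrite -addn1 iotaD big_cat /= mulrA IH big_seq1 add0n.
have -> : 2 ^+ (N + 1) * u = 2 ^+ N * u + 2 ^+ N * u by rewrite addn1 exprS; ring.
rewrite cosTD addn1 exprS invfM.
have := cosT2DsinT2 (2 ^+ N * u); move: (cosT _) (sinT _) => c s; rewrite !expr2 => h.
have -> : s * s = 1 - c * c by rewrite -h addrAC subrr add0r.
by field; rewrite expf_neq0.
Qed.

Lemma riesz_dyadics N I x : (forall i, i \in I -> (i < K)%N) ->
  riesz (dyadics N I) x =
  \prod_(i <- I) \prod_(j <- iota 0 N) (1 + cosT (2 ^+ j * (t i x - e i))).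
Proof.
elim: I => [|i I IH] IK; first by rewrite /riesz !big_nil.
rewrite big_cons -IH; last by move=> k kI; apply: IK; rewrite in_cons kI orbT.
rewrite {1}/riesz /dyadics /= big_cat /= big_map; congr (_ * _).
apply: eq_bigr => j _; rewrite /wave phase_dyadic//.
by apply: IK; rewrite mem_head.
Qed.

(** Suppose that every [x] misses the target in some direction [i].  The Riesz
    product over all directions has mean 1; where direction [i] misses by [d],
    its Fejer factor is bounded by [2 / (d * 2 ^ N)], and the remaining
    factors again have mean 1.  Summing over [i] gives [d <= 2 K / 2 ^ N] for
    every [N]. *)
Lemma kronecker (d : R) : 0 < d ->
  exists x, forall i, (i < K)%N -> 1 - d <= cosT (t i x - e i).
Proof.
move=> d0; apply: contrapT => /forallNP H.
have far x : exists2 i, (i < K)%N & cosT (t i x - e i) < 1 - d.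
  have /existsNP[i /not_implyP[iK /negP]] := H x.
  by rewrite -ltNge; exists i.
have [N HN] : exists N : nat, K%:R * (2 / 2 ^+ N) < d.
  pose N := Num.truncn (K%:R * 2 / d).
  exists N.+1; have : K%:R * 2 / d < N.+1%:R by exact: truncnS_gt.
  rewrite ltr_pdivrMr// => h.
  have p2 : 0 < 2 ^+ N.+1 :> R by rewrite exprn_gt0.
  rewrite mulrA ltr_pdivrMr//; apply: lt_trans h _.
  by rewrite mulrC ltr_pM2l// -natrX ltr_nat ltn_expl.
pose I := iota 0 K.
have IK i : i \in I -> (i < K)%N by rewrite mem_iota.
pose P J x := riesz (dyadics N J) x.
have P_ge0 J x : 0 <= P J x.
  apply: prodr_ge0 => a _; have := cosT_geN1 (phase a x); rewrite /wave; lra.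
have cP J : continuous (P J) by exact: riesz_cont.
have mP J : uniq J -> (forall i, i \in J -> (i < K)%N) -> mean (P J) = 1.
  by move=> uJ JK; apply: mean_riesz; exact: dyadics_dissociated.
have uI : uniq I by exact: iota_uniq.
have remK i j : j \in rem i I -> (j < K)%N by move=> /mem_rem; exact: IK.
have rem1 i x : i \in I -> (1 - cosT (t i x - e i)) * P I x <= 2 / 2 ^+ N * P (rem i I) x.
  move=> iI; have -> : P I x =
      (\prod_(j <- iota 0 N) (1 + cosT (2 ^+ j * (t i x - e i)))) * P (rem i I) x.
    by rewrite /P !riesz_dyadics ?(big_rem i iI)//; exact: remK.
  rewrite mulrA fejer_bound; apply: ler_wpM2r => //.
  apply: ler_wpM2r; first by rewrite invr_ge0 exprn_ge0.
  have := cosT_geN1 (2 ^+ N * (t i x - e i)); lra.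
have key x : d * P I x <= \sum_(i <- I) 2 / 2 ^+ N * P (rem i I) x.
  have [i iK ci] := far x.
  have iI : i \in I by rewrite mem_iota.
  apply: le_trans (_ : _ <= 2 / 2 ^+ N * P (rem i I) x) _.
    apply: le_trans (rem1 i x iI); apply: ler_wpM2r => //; lra.
  rewrite (big_rem i iI) /= lerDl; apply: sumr_ge0 => j _.
  by rewrite mulr_ge0// divr_ge0// exprn_ge0.
have : d <= K%:R * (2 / 2 ^+ N).
  have -> : d = mean (fun x => d * P I x) by rewrite meanZ// mP// mulr1.
  have -> : K%:R * (2 / 2 ^+ N) = mean (fun x => \sum_(i <- I) 2 / 2 ^+ N * P (rem i I) x).
    rewrite mean_sum//; last by move=> i; exact: contZ.
    rewrite (eq_bigr (fun=> 2 / 2 ^+ N)).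
      by rewrite big_const_seq count_predT size_iota iter_addr_0 mulr_natl.
    move=> i _; rewrite meanZ// mP ?mulr1 ?rem_uniq//; exact: remK.
  apply: mean_le => //; first exact: contZ.
  by apply: cont_sum => i; exact: contZ.
by rewrite leNgt HN.
Qed.

End Kronecker.

(** * Polynomials acting on functions through a self-map *)

Section PolynomialAction.
Variables (A : comNzRingType) (S : Type) (phi : S -> S).
Implicit Types (p q : {poly A}) (v : S -> A).

Definition polyact p v (s : S) : A := \sum_(i < size p) p`_i * v (iter i phi s).

(** The sum may run past the degree, which lets polynomials of different sizes
    be compared term by term. *)
Lemma polyact_wide n p v s : (size p <= n)%N ->
  polyact p v s = \sum_(i < n) p`_i * v (iter i phi s).
Proof.
move=> pn; rewrite /polyact (big_ord_widen n (fun i => p`_i * v (iter i phi s)) pn).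
rewrite big_mkcond; apply: eq_bigr => i _; case: ltnP => // h.
by rewrite nth_default ?mul0r.
Qed.

Lemma polyactD p q v s : polyact (p + q) v s = polyact p v s + polyact q v s.
Proof.
have pn := leq_maxl (size p) (size q); have qn := leq_maxr (size p) (size q).
rewrite (polyact_wide _ _ pn) (polyact_wide _ _ qn).
rewrite (polyact_wide _ _ (size_polyD p q)) -big_split /=.
by apply: eq_bigr => i _; rewrite coefD mulrDl.
Qed.

Lemma polyact0 v s : polyact 0 v s = 0.
Proof. by rewrite /polyact size_poly0 big_ord0. Qed.

Lemma polyactC c v s : polyact c%:P v s = c * v s.
Proof.
by rewrite (polyact_wide _ _ (size_polyC_leq1 c)) big_ord1 coefC.
Qed.

Lemma polyactMX p v s : polyact (p * 'X) v s = polyact p v (phi s).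
Proof.
have h : (size (p * 'X)%R <= (size p).+1)%N.
  by apply: leq_trans (size_polyMleq _ _) _; rewrite size_polyX addn2.
rewrite (polyact_wide _ _ h) big_ord_recl coefMX /= mul0r add0r /polyact.
by apply: eq_bigr => i _; rewrite coefMX /bump /= -iterS iterSr.
Qed.

Lemma polyactM p q v s : polyact (p * q) v s = polyact p (polyact q v) s.
Proof.
elim/poly_ind: p s => [|p c IH] s; first by rewrite mul0r !polyact0.
rewrite mulrDl polyactD -mulrA (mulrC 'X) mulrA polyactMX IH polyactD polyactMX.
congr (_ + _); rewrite polyactC.
rewrite mul_polyC (polyact_wide _ _ (size_scale_leq c q)) /polyact mulr_sumr.
by apply: eq_bigr => i _; rewrite coefZ mulrA.
Qed.

Lemma polyact_sub p v w s :
  polyact p (fun x => v x - w x) s = polyact p v s - polyact p w s.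
Proof. by rewrite /polyact -sumrB; apply: eq_bigr => i _; rewrite mulrBr. Qed.

Lemma polyact_scale p c v s : polyact p (fun x => c * v x) s = c * polyact p v s.
Proof. by rewrite /polyact mulr_sumr; apply: eq_bigr => i _; rewrite mulrCA. Qed.

End PolynomialAction.

(** * Integral orbits and the annihilator of a character *)

Section Automorphism.
Variables (R : realType) (X : topologicalZmodType).
Hypothesis compactX : compact [set: X].
Hypothesis hausdorffX : hausdorff_space X.
Hypothesis connectedX : connected [set: X].
Variable alpha : continuous_automorphism X.

Lemma aut_iter1D n x : aut_iter alpha (1 + n) x = alpha (aut_iter alpha n x).
Proof.
case: n => [n|[|n]]; [by []|by rewrite /= aut_invK|].
by rewrite (_ : 1 + Negz n.+1 = Negz n); [rewrite /= aut_invK|lia].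
Qed.

Lemma aut_iterN1D n x : aut_iter alpha (-1 + n) x = aut_inv alpha (aut_iter alpha n x).
Proof.
by have := aut_iter1D (-1 + n) x; rewrite addrA subrr add0r => ->; rewrite aut_funK.
Qed.

Lemma aut_iterD m n x : aut_iter alpha (m + n) x = aut_iter alpha m (aut_iter alpha n x).
Proof.
elim/int_ind: m => [|m IH|m IH]; first by rewrite add0r.
  by rewrite -addn1 addnC PoszD -addrA !aut_iter1D IH.
by rewrite -addn1 addnC PoszD opprD -addrA !aut_iterN1D IH.
Qed.

(** A continuous bijection from a compact space to a Hausdorff one is closed. *)
Lemma aut_inv_continuous : continuous (aut_inv alpha).
Proof.
apply/continuous_closedP => F cF.
have -> : aut_inv alpha @^-1` F = alpha @` F.
  apply/seteqP; split => [x /= Fx|_ [y Fy <-] /=]; last by rewrite aut_funK.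
  by exists (aut_inv alpha x) => //; rewrite aut_invK.
apply: compact_closed => //; apply: continuous_compact.
  by apply: continuous_subspaceT; exact: aut_continuous.
exact: subclosed_compact cF compactX _.
Qed.

Lemma aut_iter_continuous n : continuous (aut_iter alpha n).
Proof.
have it (f : X -> X) k : continuous f -> continuous (iter k f).
  move=> cf; elim: k => [|k IH] x /=; first exact: cvg_id.
  exact: (@continuous_comp _ _ _ (iter k f) f _ (IH x) (cf _)).
by case: n => k; apply: it; [exact: aut_continuous|exact: aut_inv_continuous].
Qed.

Lemma aut_iter_morph n : {morph aut_iter alpha n : x y / x + y}.
Proof.
have it (f : X -> X) k : {morph f : x y / x + y} -> {morph iter k f : x y / x + y}.
  by move=> fD x y; elim: k => //= k ->; rewrite fD.
case: n => k; apply: it => x y; first exact: raddfD.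
by apply: (can_inj (@aut_funK _ alpha)); rewrite raddfD !aut_invK.
Qed.

Lemma aut_iter0r n : aut_iter alpha n 0 = 0.
Proof.
have := aut_iter_morph n 0 0; rewrite addr0 => /eqP.
by rewrite -{1}[aut_iter _ _ _]addr0 (inj_eq (addrI _)) => /eqP.
Qed.

Lemma character_iter (s : X -> R) n : character s ->
  character (fun x => s (aut_iter alpha n x)).
Proof. by apply: character_comp; [exact: aut_iter_morph|exact: aut_iter_continuous]. Qed.

Definition orbit_kernel (s : X -> R) : set X :=
  [set x | forall n : int, s (aut_iter alpha n x) \is a Num.int].

Lemma orbit_kernel_finite (s : X -> R) : irreducible_aut alpha -> character s ->
  (exists x, s x \isn't a Num.int) -> finite_set (orbit_kernel s).
Proof.
move=> irr cs_ [x0 sx0]; apply: irr.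
- have -> : orbit_kernel s =
      \bigcap_(n in [set: int]) [set x | s (aut_iter alpha n x) \is a Num.int].
    by apply/seteqP; split => x H n; [move=> _|]; exact: H.
  apply: closed_bigI => n _.
  exact: (character_kernel_closed (character_iter n cs_)).
- split.
    by rewrite in_setE => n; rewrite aut_iter0r; exact: character_at0.
  move=> x y; rewrite !in_setE => Hx Hy n.
  exact: (character_int_sub (character_iter n cs_) (Hx n) (Hy n)).
- apply/seteqP; split => [_ [x Hx <-] n|x Hx].
    by rewrite -[alpha x]/(aut_iter alpha 1 x) -aut_iterD.
  exists (aut_inv alpha x); last by rewrite aut_invK.
  by move=> n; rewrite -[aut_inv alpha x]/(aut_iter alpha (-1) x) -aut_iterD.
- move=> E; have : orbit_kernel s x0 by rewrite E.
  by move=> /(_ 0) /=; rewrite (negPf sx0).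
Qed.

Lemma character_polyact (t : X -> R) (f : {poly int}) : character t ->
  character (polyact alpha (map_poly intr f) t).
Proof.
move=> ct; apply: character_sum => i; rewrite coef_map /=.
by apply: characterZ; exact: (character_iter i%:Z ct).
Qed.

(** If no polynomial annihilates [t], Kronecker's theorem and compactness give,
    for each [j], a point [w j] with [t] equal to 1/2 at time [j] and to 0 at all
    other times, modulo 1.  These are infinitely many points where [2 * t] is
    integral along the orbit. *)
Lemma annihilator_exists (t : X -> R) : irreducible_aut alpha -> character t ->
  (exists x, t x \isn't a Num.int) ->
  exists2 f : {poly int}, f != 0 &
    forall x, polyact alpha (map_poly intr f) t x \is a Num.int.
Proof.
move=> irr ct tn0; apply: contrapT => H.
have indep K (c : nat -> int) : (exists2 i, (i < K)%N & c i != 0) ->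
    exists x, \sum_(i < K) (c i)%:~R * t (iter i alpha x) \isn't a Num.int.
  move=> [i iK ci]; apply: contrapT => /forallNP Hx; apply: H.
  exists (\poly_(i < K) c i).
    apply: contraNneq ci => /(congr1 (fun p : {poly int} => p`_i)).
    by rewrite coef_poly iK coef0 => ->.
  move=> x; have /negP := Hx x; rewrite negbK.
  rewrite (polyact_wide _ (n := K)).
    by under [X in _ -> X \is a _]eq_bigr => j _ do rewrite coef_map coef_poly ltn_ord.
  exact: leq_trans (size_poly _ _) (size_poly _ _).
have point (j : nat) : exists x, forall n : int,
    cosT (t (aut_iter alpha n x) - (n == j%:Z)%:R / 2) = 1.
  (* On the window |n| <= N: approximate at the times 0, ..., 2 N, then shift
     time by N. *)
  have approx (N : nat) : exists x, forall n : int, (absz n <= N)%N ->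
      1 - N.+1%:R^-1 <= cosT (t (aut_iter alpha n x) - (n == j%:Z)%:R / 2).
    have [] := @kronecker R X compactX (N + N).+1 (fun i x => t (iter i alpha x))
      (fun i => (i%:Z == N%:Z + j%:Z)%:R / 2) _ _ N.+1%:R^-1.
    - by move=> i; exact: (character_iter i%:Z ct).
    - exact: indep.
    - by [].
    move=> y Hy; exists (aut_iter alpha N%:Z y) => n nN.
    pose i := absz (n + N%:Z).
    have iE : (i : int) = n + N%:Z by rewrite /i; lia.
    have iN : (i < (N + N).+1)%N by lia.
    have := Hy i iN; rewrite -[iter i alpha y]/(aut_iter alpha (i : int) y).
    rewrite -aut_iterD iE.
    by have -> : (n == j%:Z) = (n + N%:Z == N%:Z + j%:Z) by lia.
  have [f Hf] := choice approx.
  have [x [_ clx]] := compactX (fmap_proper_filter f eventually_filter) filterT.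
  exists x => n; set e := _ / 2.
  have cc : continuous (fun x => cosT (t (aut_iter alpha n x) - e)).
    have [_ c1 c2] := character_iter n ct.
    under eq_fun do rewrite cosTB; apply: contD; apply: contM => //; exact: cont_cst.
  apply/eqP; rewrite eq_le cosT_le1 /=; apply/ler_addgt0Pl => d d0.
  rewrite -lerBlDl.
  pose A := [set x | 1 - d <= cosT (t (aut_iter alpha n x) - e)].
  have cA : closed A.
    apply: (@preimage_closed _ _ (fun x => cosT (t (aut_iter alpha n x) - e))
      [set y | 1 - d <= y]) => [y _|]; [exact: cc|exact: closed_ge].
  have FA : (f @ \oo) A.
    exists (maxn `|n|%N (Num.truncn d^-1)) => // N /=; rewrite geq_max => /andP[nN dN].
    apply: le_trans (Hf N n nN); rewrite lerD2l lerN2.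
    rewrite -[leRHS]invrK lef_pV2 ?posrE ?invr_gt0//.
    apply: ltW; apply: lt_le_trans (truncnS_gt _) _.
    by rewrite ler_nat.
  by have := clx; rewrite clusterE => /(_ A FA); rewrite -(closure_id A).1.
have [w Hw] := choice point.
have half : (1 / 2 : R) \isn't a Num.int.
  apply/negP => /intrP[m Hm].
  have : (1 : R) = (2 * m)%:~R by rewrite intrM -Hm; lra.
  by move=> /(intr_inj (x1 := 1)); lia.
have ct2 : character (fun x => 2%:~R * t x) by exact: characterZ.
have fin : finite_set (orbit_kernel (fun x => 2%:~R * t x)).
  by apply: orbit_kernel_finite => //; exact: character_scale_nontrivial.
apply: infinite_nat.
have -> : [set: nat] = w @^-1` (orbit_kernel (fun x => 2%:~R * t x)).
  apply/esym/seteqP; split => // j _ n /=.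
  have /cosT_eq1 := Hw j n; set b := (n == j%:Z)%:R => h.
  rewrite (_ : 2%:~R * _ = 2%:~R * (t (aut_iter alpha n (w j)) - b / 2) + b); last by field.
  by rewrite rpredD ?rpredM ?natr_int ?intr_int.
apply: finite_preimage fin => i j _ _ wij; apply/eqP; apply: contraNT half => ij.
have /cosT_eq1 := Hw i i; have /cosT_eq1 := Hw j i; rewrite -wij eqxx.
have -> : (i%:Z == j%:Z) = false by lia.
rewrite mul0r subr0 => h1 h2.
by rewrite -[1 / 2](subKr (t (aut_iter alpha i (w i)))) rpredB.
Qed.

End Automorphism.

(** * Linear recurrences on bi-infinite complex sequences *)

Section BiinfiniteSequences.
Variable R : realType.
Local Notation C := (complex R).
Implicit Types (v w : int -> C) (p q : {poly C}) (z : C).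

Local Notation nm := (@ComplexField.Normc.normc R).

Let nm_ge0 z : 0 <= nm z. Proof. by case: z => a b /=; exact: sqrtr_ge0. Qed.
Let nmM (x y : C) : nm (x * y) = nm x * nm y. Proof. exact: ComplexField.Normc.normcM. Qed.
Let nmD (x y : C) : nm (x + y) <= nm x + nm y. Proof. exact: le_normcD. Qed.
Let nmX z n : nm (z ^+ n) = nm z ^+ n.
Proof.
elim: n => [|n IH]; first by rewrite !expr0 ComplexField.Normc.normc1.
by rewrite !exprS nmM IH.
Qed.
Let nm0 z : nm z <= 0 -> z = 0.
Proof.
by move=> h; apply: ComplexField.Normc.eq0_normc; apply/eqP; rewrite eq_le h nm_ge0.
Qed.

Definition int_succ (n : int) : int := n + 1.

Lemma iter_int_succ k n : iter k int_succ n = n + k%:Z.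
Proof. by elim: k => [|k IH]; [rewrite addr0|rewrite iterS IH /int_succ; lia]. Qed.

Definition bounded_seq v := exists B, forall n, nm (v n) <= B.

Definition vanishing v := forall e : R, 0 < e ->
  exists N : nat, forall n : int, (N <= absz n)%N -> nm (v n) < e.

Lemma bounded_polyact p v : bounded_seq v -> bounded_seq (polyact int_succ p v).
Proof.
move=> [B HB]; exists (\sum_(i < size p) nm p`_i * B) => n.
rewrite /polyact; elim/big_ind2: _ => [|x1 x2 y1 y2 h1 h2|i _].
- by rewrite ComplexField.Normc.normc0.
- exact: le_trans (nmD _ _) (lerD h1 h2).
- by rewrite nmM ler_wpM2l.
Qed.

Lemma vanishing_polyact p v : vanishing v -> vanishing (polyact int_succ p v).
Proof.
move=> vv; rewrite /polyact.
elim: (size p) => [|m IH] e e0.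
  by exists 0%N => n _; rewrite big_ord0 ComplexField.Normc.normc0.
have e20 : 0 < e / 2 by rewrite divr_gt0.
have c1 : 0 < nm p`_m + 1 by rewrite ltr_wpDl.
have [N HN] := IH _ e20; have [M HM] := vv _ (divr_gt0 e20 c1).
exists (N + (M + m))%N => n nN; rewrite big_ord_recr /=.
apply: le_lt_trans (nmD _ _) _; rewrite [e]splitr; apply: ltrD.
  by apply: HN; lia.
rewrite nmM iter_int_succ; have := HM (n + m%:Z) ltac:(lia).
rewrite ltr_pdivlMr// => h; apply: le_lt_trans h.
by rewrite mulrC ler_wpM2l// ler_wpDr.
Qed.

Lemma polyact_Xsub z v n : polyact int_succ ('X - z%:P) v n = v (n + 1) - z * v n.
Proof.
by rewrite -polyCN polyactD polyactC -['X]mul1r polyactMX -[1]/(1%:P) polyactC mul1r mulNr.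
Qed.

(** Factoring the recurrence into first-order ones: a class of sequences stable
    under polynomials in the shift contains no nonzero solution as soon as it
    contains no nonzero geometric sequence for the roots. *)
Lemma kill_roots (V : (int -> C) -> Prop) (rs : seq C) v :
  (forall p w, V w -> V (polyact int_succ p w)) ->
  (forall z w, z \in rs -> V w -> (forall n, w (n + 1) = z * w n) -> forall n, w n = 0) ->
  V v -> (forall n, polyact int_succ (\prod_(z <- rs) ('X - z%:P)) v n = 0) ->
  forall n, v n = 0.
Proof.
move=> Vp; elim: rs => [|z rs IH] Vz Vv H n.
  by have := H n; rewrite big_nil -[1]/(1%:P) polyactC mul1r.
apply: IH => //; first by move=> z' w z'rs; apply: Vz; rewrite in_cons z'rs orbT.
apply: (Vz z); first by rewrite mem_head.
  exact: Vp.
move=> m; have := H m; rewrite big_cons polyactM polyact_Xsub.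
by move/eqP; rewrite subr_eq0 => /eqP.
Qed.

Lemma kill_poly (V : (int -> C) -> Prop) p v : p != 0 ->
  (forall q w, V w -> V (polyact int_succ q w)) ->
  (forall z w, root p z -> V w -> (forall n, w (n + 1) = z * w n) -> forall n, w n = 0) ->
  V v -> (forall n, polyact int_succ p v n = 0) -> forall n, v n = 0.
Proof.
move=> p0 Vp Vz Vv H; have [rs prs] := closed_field_poly_normal p.
have l0 : lead_coef p != 0 by rewrite lead_coef_eq0.
apply: (@kill_roots V rs) => //.
  move=> z w zrs; apply: Vz; rewrite prs rootZ// root_prod_XsubC//.
move=> n; have := H n; rewrite {1}prs -mul_polyC polyactM polyactC => /eqP.
by rewrite mulf_eq0 (negPf l0) => /eqP.
Qed.

Lemma geometric_seq z w : (forall n, w (n + 1) = z * w n) ->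
  forall (k : nat) n, w (n + k%:Z) = z ^+ k * w n.
Proof.
move=> H; elim=> [|k IH] n; first by rewrite addr0 mul1r.
by rewrite -addn1 PoszD addrA H IH addn1 exprS mulrA.
Qed.

Lemma geometric_le0 (a B r : R) : 0 <= r -> r < 1 -> (forall k, a <= B * r ^+ k) -> a <= 0.
Proof.
move=> r0 r1 H; have cv : geometric B r @ \oo --> (0 : R).
  by apply: cvg_geometric; rewrite ger0_norm.
rewrite -(cvg_lim _ cv)//; apply: limr_ge; first by apply/cvg_ex; exists 0.
by near=> k; exact: H.
Unshelve. all: by end_near. Qed.

Lemma bounded_kill p v : p != 0 -> (forall z, root p z -> nm z != 1) ->
  bounded_seq v -> (forall n, polyact int_succ p v n = 0) -> forall n, v n = 0.
Proof.
move=> p0 Hp; apply: kill_poly => // [q w|z w /Hp z1 [B HB] H n].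
  exact: bounded_polyact.
have G := geometric_seq H; apply: nm0.
have [zl|zg] := ltP (nm z) 1.
  apply: (@geometric_le0 _ B (nm z)) => // k.
  have := G k (n - k%:Z); rewrite subrK => ->.
  by rewrite nmM nmX mulrC ler_wpM2r ?exprn_ge0.
have z2 : 1 < nm z by rewrite lt_neqAle eq_sym z1.
have z0 : 0 < nm z by exact: lt_trans z2.
apply: (@geometric_le0 _ B (nm z)^-1) => [||k]; first by rewrite invr_ge0.
  by rewrite invf_lt1.
have := HB (n + k%:Z); rewrite G nmM nmX exprVn ler_pdivlMr ?exprn_gt0//.
by rewrite mulrC.
Qed.

(** A nonzero geometric sequence does not tend to 0 at both ends, whatever its
    ratio. *)
Lemma vanishing_kill p v : p != 0 ->
  vanishing v -> (forall n, polyact int_succ p v n = 0) -> forall n, v n = 0.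
Proof.
move=> p0; apply: kill_poly => // [q w|z w _ vw H n]; first exact: vanishing_polyact.
have G := geometric_seq H; apply: nm0; apply/ler_addgt0Pl => e e0; rewrite addr0.
have [N HN] := vw e e0.
have [zl|zg] := leP (nm z) 1.
  have := G (N + absz n)%N (n - (N + absz n)%N%:Z); rewrite subrK => ->.
  rewrite nmM nmX; have h := HN (n - (N + absz n)%N%:Z) ltac:(lia).
  apply: le_trans (ltW h); rewrite -[leRHS]mul1r ler_wpM2r//.
  by rewrite exprn_ile1.
have h := HN (n + (N + absz n)%N%:Z) ltac:(lia).
apply: le_trans (ltW h); rewrite G nmM nmX -[leLHS]mul1r ler_wpM2r//.
by rewrite exprn_ege1// ltW.
Qed.

(** Write [p = q (X - z)] and [w = q(shift) v].  The sum telescopes to boundary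
    values of [w].  Beyond the support of [p(shift) v] the modulus of [w] is
    constant because |z| = 1, and [w] tends to 0, so these values are 0. *)
Lemma vanishing_root p v z (N : nat) : root p z -> nm z = 1 -> vanishing v ->
  (forall n : int, (N%:Z <= n) || (n < - N%:Z) -> polyact int_succ p v n = 0) ->
  \sum_(j < N + N) polyact int_succ p v (N%:Z - 1 - j%:Z) * z ^+ j = 0.
Proof.
move=> /factor_theorem[q ->] z1 vv H.
pose w := polyact int_succ q v.
have hw n : polyact int_succ (q * ('X - z%:P)) v n = w (n + 1) - z * w n.
  by rewrite mulrC polyactM polyact_Xsub.
have vw : vanishing w by exact: vanishing_polyact.
have up (k : nat) : nm (w (N%:Z + k%:Z)) = nm (w N%:Z).
  elim: k => [|k IH]; first by rewrite addr0.
  have := H (N%:Z + k%:Z) ltac:(lia); rewrite hw => /eqP; rewrite subr_eq0 => /eqP h.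
  by rewrite -addn1 PoszD addrA h nmM z1 mul1r IH.
have down (k : nat) : nm (w (- N%:Z - k%:Z)) = nm (w (- N%:Z)).
  elim: k => [|k IH]; first by rewrite subr0.
  have := H (- N%:Z - k.+1%:Z) ltac:(lia); rewrite hw => /eqP; rewrite subr_eq0 => /eqP h.
  by rewrite -IH (_ : - N%:Z - k%:Z = - N%:Z - k.+1%:Z + 1) ?h ?nmM ?z1 ?mul1r//; lia.
have wN : w N%:Z = 0.
  apply: nm0; apply/ler_addgt0Pl => e e0; rewrite addr0; have [M HM] := vw e e0.
  by rewrite -(up M); apply/ltW/HM; lia.
have wNN : w (- N%:Z) = 0.
  apply: nm0; apply/ler_addgt0Pl => e e0; rewrite addr0; have [M HM] := vw e e0.
  by rewrite -(down M); apply/ltW/HM; lia.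
have tele m : \sum_(j < m) polyact int_succ (q * ('X - z%:P)) v (N%:Z - 1 - j%:Z) * z ^+ j =
    w N%:Z - w (N%:Z - m%:Z) * z ^+ m.
  elim: m => [|m IH]; first by rewrite big_ord0 subr0 mulr1 subrr.
  rewrite big_ord_recr /= IH hw.
  have -> : N%:Z - 1 - m%:Z + 1 = N%:Z - m%:Z by lia.
  have -> : N%:Z - m.+1%:Z = N%:Z - 1 - m%:Z by lia.
  by rewrite exprS; ring.
by rewrite tele wN (_ : N%:Z - (N + N)%N%:Z = - N%:Z) ?wNN ?mul0r ?subrr//; lia.
Qed.

End BiinfiniteSequences.

(** * Homoclinic points *)

Section Homoclinic.
Variables (R : realType) (X : topologicalZmodType).
Hypothesis compactX : compact [set: X].
Hypothesis hausdorffX : hausdorff_space X.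
Hypothesis connectedX : connected [set: X].
Variable alpha : continuous_automorphism X.
Hypothesis irreducible_alpha : irreducible_aut alpha.
Local Notation C := (complex R).
Local Notation nm := (@ComplexField.Normc.normc R).
Local Notation mapR f := (map_poly (intr : int -> R) f).
Local Notation mapC f := (map_poly (intr : int -> C) f).
Local Notation toC := (real_complex R).
Implicit Types (f g r : {poly int}) (t : X -> R).

Lemma normc_real (x : R) : nm (toC x) = `|x|.
Proof. by rewrite /= expr0n addr0 sqrtr_sqr. Qed.

Lemma polyact_toC f (v : int -> R) n :
  polyact int_succ (mapC f) (fun m => toC (v m)) n = toC (polyact int_succ (mapR f) v n).
Proof.
rewrite (polyact_wide _ _ _ (size_poly _ _ : (size (mapC f) <= size f)%N)).
rewrite (polyact_wide _ _ _ (size_poly _ _ : (size (mapR f) <= size f)%N)).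
rewrite rmorph_sum; apply: eq_bigr => i _.
by rewrite rmorphM !coef_map /= rmorph_int.
Qed.

Lemma polyact_orbit (p : {poly R}) t x n :
  polyact int_succ p (fun m => t (aut_iter alpha m x)) n =
  polyact alpha p t (aut_iter alpha n x).
Proof.
apply: eq_bigr => i _; rewrite iter_int_succ addrC aut_iterD.
by [].
Qed.

Lemma mapC_neq0 f : f != 0 -> mapC f != 0.
Proof.
by rewrite -!size_poly_eq0 (size_map_inj_poly (@intr_inj C))// mulr0z.
Qed.

Definition annihilates f t := forall x, polyact alpha (mapR f) t x \is a Num.int.

Definition nontrivial t := exists x, t x \isn't a Num.int.

Definition frac_orbit t x (n : int) : R :=
  t (aut_iter alpha n x) - nearest_int (t (aut_iter alpha n x)).

Lemma frac_orbit_int f t x n : annihilates f t ->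
  polyact int_succ (mapR f) (frac_orbit t x) n \is a Num.int.
Proof.
move=> ft; rewrite /frac_orbit polyact_sub polyact_orbit rpredB//.
by apply: rpred_sum => i _; rewrite coef_map rpredM ?intr_int ?nearest_int_int.
Qed.

Lemma finite_isolated (Y : set X) : finite_set Y -> nbhs 0 (~` (Y `\` [set 0])).
Proof.
move=> fY; apply: open_nbhs_nbhs; split; last by move=> [_]; apply.
apply: closed_openC.
have /accessible_finite_set_closed := hausdorff_accessible hausdorffX; apply.
exact: finite_setD.
Qed.

Lemma int_small (a : R) : a \is a Num.int -> `|a| < 1 -> a = 0.
Proof.
move=> /intrP[m ->]; rewrite -intr_norm (ltr_int _ _ 1) => h.
by have -> : m = 0 by lia.
Qed.

(** The width [e] is chosen so small that [f(shift)] applied to the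
    representatives, an integer of modulus less than 1, vanishes. *)
Lemma expansive_of_no_unit_root f t : character t -> nontrivial t -> f != 0 ->
  annihilates f t -> (forall z, root (mapC f) z -> nm z != 1) -> expansive_aut alpha.
Proof.
move=> ct tn0 f0 ft noroot.
pose F : R := \sum_(i < size f) `|(f`_i)%:~R|.
have F0 : 0 <= F by apply: sumr_ge0.
pose e : R := (F + 1)^-1.
have e0 : 0 < e by rewrite invr_gt0 ltr_wpDl.
pose Y := orbit_kernel alpha t.
have fY : finite_set Y by exact: orbit_kernel_finite.
exists ([set x | `|t x - nearest_int (t x)| < e] `&` ~` (Y `\` [set 0])).
  by apply: filterI; [exact: character_near0|exact: finite_isolated].
apply/seteqP; split => [x H|_ -> n _]; last first.
  exists 0; last by rewrite aut_iter0r.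
  split => /=; last by move=> [_]; apply.
  have t0 := character_at0 ct; have [m ->] := intrP t0.
  rewrite (_ : m%:~R - nearest_int _ = 0) ?normr0//.
  apply: int_small; first by rewrite rpredB ?intr_int ?nearest_int_int.
  by apply: le_lt_trans (nearest_int_half _) _; rewrite ltr_pdivrMr// mul1r ltr1n.
have HW n : `|frac_orbit t x n| < e /\ ~ (Y `\` [set 0]) (aut_iter alpha n x).
  have [y [y1 y2] yx] := H (- n) I.
  by rewrite /frac_orbit -yx -aut_iterD subrr /=.
have l0 n : polyact int_succ (mapR f) (frac_orbit t x) n = 0.
  apply: int_small; first exact: frac_orbit_int.
  rewrite (polyact_wide _ _ _ (size_poly _ _ : (size (mapR f) <= size f)%N)).
  apply: (@le_lt_trans _ _ (F * e)).
    apply: le_trans (ler_norm_sum _ _ _) _; rewrite /F mulr_suml.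
    apply: ler_sum => i _; rewrite normrM coef_map /=.
    by apply: ler_wpM2l => //; apply: ltW; exact: (HW _).1.
  by rewrite /e ltr_pdivrMr ?ltr_wpDl// mul1r ltrDl.
have v0 : forall n, toC (frac_orbit t x n) = 0.
  apply: (@bounded_kill R (mapC f)) => //; first exact: mapC_neq0.
    by exists e => n; rewrite normc_real; apply: ltW; exact: (HW n).1.
  by move=> n; rewrite polyact_toC l0.
have Yx : Y x.
  move=> n; have := v0 n => /(congr1 (@complex.Re R)) /= /eqP.
  by rewrite subr_eq0 => /eqP ->; exact: nearest_int_int.
apply: contrapT => xn0; apply: (HW 0).2; split => //.
Qed.

Lemma pseudo_division (p q : {poly int}) : q != 0 -> exists (c : int) (a b : {poly int}),
  [/\ c != 0, c%:P * p = a * q + b & (size b < size q)%N].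
Proof.
move=> q0; exists (lead_coef q ^+ scalp p q), (p %/ q)%R, (p %% q)%R; split.
- by rewrite expf_neq0// lead_coef_eq0.
- by rewrite mul_polyC Pdiv.Idomain.divp_eq.
- by rewrite Pdiv.Idomain.ltn_modp.
Qed.

Lemma annihilates_mul f g t : annihilates (f * g) t <->
  annihilates f (polyact alpha (mapR g) t).
Proof. by split=> H x; have := H x; rewrite rmorphM /= polyactM. Qed.

Lemma annihilatesZ (c : int) f t : annihilates f t -> annihilates (c%:P * f) t.
Proof.
move=> ft x; rewrite rmorphM /= map_polyC /= polyactM polyactC.
by rewrite rpredM ?intr_int.
Qed.

(** Take [(t, f)] with [f] of least size.  If the minimal polynomial [r] of the
    unit root [z] were smaller, pseudo-division would give [c * f = a * r]:
    either [a] annihilates [t], or [r] annihilates the nontrivial character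
    [a(alpha) t]; both contradict the minimality of [f]. *)
Lemma critical_character : ~ expansive_aut alpha ->
  (exists2 t, character t & nontrivial t) ->
  exists t f z, [/\ character t, nontrivial t, annihilates f t &
    [/\ f != 0, root (mapC f) z, nm z = 1 &
        forall r, root (mapC r) z -> (size r < size f)%N -> r = 0]].
Proof.
move=> nexp [t0 ct0 tn0].
pose P n := `[< exists t f,
  [/\ character t, nontrivial t, annihilates f t, f != 0 & size f = n] >].
have exP : exists n, P n.
  have [f f0 ft] :=
    annihilator_exists compactX hausdorffX connectedX irreducible_alpha ct0 tn0.
  by exists (size f); apply/asboolP; exists t0, f.
case: (ex_minnP exP) => n /asboolP[t [f [ct tn ft f0 sf]]] fmin.
have {}fmin t' f' : character t' -> nontrivial t' -> annihilates f' t' -> f' != 0 ->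
    (size f <= size f')%N.
  by move=> *; rewrite sf; apply: fmin; apply/asboolP; exists t', f'.
have [z zf z1] : exists2 z, root (mapC f) z & nm z = 1.
  apply: contrapT => H; apply: nexp; apply: (expansive_of_no_unit_root ct tn f0 ft).
  by move=> z zf; apply/eqP => z1; apply: H; exists z.
exists t, f, z; split => //; split => // r0 r0z r0f.
apply: contrapT => /eqP r0n.
pose Q m := `[< exists r, [/\ root (mapC r) z, r != 0 & size r = m] >].
have exQ : exists m, Q m by exists (size r0); apply/asboolP; exists r0.
case: (ex_minnP exQ) => m /asboolP[r [rz rn rm]] rmin.
have rf : (size r < size f)%N.
  by apply: leq_ltn_trans r0f; rewrite rm; apply: rmin; apply/asboolP; exists r0.
have r1 : (1 < size r)%N.
  rewrite ltnNge; apply/negP => /size1_polyC E; move: rz.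
  rewrite E map_polyC rootC intr_eq0 => /eqP c0.
  by move: rn; rewrite E c0 eqxx.
have [c [a [b [c0 E sb]]]] := pseudo_division f rn.
have b0 : b = 0.
  apply: contrapT => /eqP bn.
  have bz : root (mapC b) z.
    have Eb : b = c%:P * f - a * r by rewrite E addrAC subrr add0r.
    rewrite /root Eb rmorphB !rmorphM /= hornerD hornerN !hornerM.
    by rewrite (eqP zf) (eqP rz) !mulr0 subrr.
  have : (m <= size b)%N by apply: rmin; apply/asboolP; exists b.
  by rewrite -rm leqNgt sb.
rewrite b0 addr0 in E.
have cf : c%:P * f != 0 by rewrite mulf_neq0// polyC_eq0.
have an : a != 0 by apply: contraNneq cf => a0; rewrite E a0 mul0r.
have ar : annihilates (r * a) t by rewrite mulrC -E; exact: annihilatesZ.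
have [at_triv|at_n] := pselect (annihilates a t).
  have := fmin _ _ ct tn at_triv an.
  have : size (c%:P * f) = size f by rewrite size_Cmul.
  rewrite E size_mul// => sE; rewrite -sE => h.
  move: r1 h; case: (size r) => [|[|k]]// _.
  by rewrite !addnS /= ltnNge leq_addr.
have ca : character (polyact alpha (mapR a) t) by exact: character_polyact.
have na : nontrivial (polyact alpha (mapR a) t).
  apply: contrapT => /forallNP H; apply: at_n => x.
  by have /negP := H x; rewrite negbK.
by have := fmin _ r ca na ((annihilates_mul r a t).1 ar) rn; rewrite leqNgt rf.
Qed.

Lemma homoclinicP x : homoclinic alpha x -> forall U : set X, nbhs 0 U ->
  exists N : nat, forall n : int, (N <= absz n)%N -> U (aut_iter alpha n x).
Proof. by move=> hx U /hx [N _ HN]; exists N => n Nn; exact: HN. Qed.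

(** In a finite set the orbit eventually equals 0, and [alpha] is injective. *)
Lemma homoclinic_finite (Y : set X) x : finite_set Y -> homoclinic alpha x ->
  (forall n, Y (aut_iter alpha n x)) -> x = 0.
Proof.
move=> fY /homoclinicP hx Yx; have [N HN] := hx _ (finite_isolated fY).
have aN0 : aut_iter alpha N%:Z x = 0.
  apply: contrapT => n0; by apply: (HN N%:Z (leqnn N)); split.
have := aut_iterD alpha (- N%:Z) N%:Z x.
by rewrite addNr aN0 aut_iter0r.
Qed.

Lemma frac_orbit_vanishing t x : character t -> homoclinic alpha x ->
  vanishing (fun n => toC (frac_orbit t x n)).
Proof.
move=> ct /homoclinicP hx e e0; have [N HN] := hx _ (character_near0 ct e0).
by exists N => n Nn; rewrite normc_real; exact: HN.
Qed.

(** The quotient [q] of [c * H] by [f] supplies the integer sequence [g]; the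
    index reversal [n = N - 1 - j] is due to the shift acting on sequences as
    the inverse of the variable of generating polynomials. *)
Lemma homoclinic_trivial t f z x : character t -> nontrivial t -> annihilates f t ->
  f != 0 -> root (mapC f) z -> nm z = 1 ->
  (forall r, root (mapC r) z -> (size r < size f)%N -> r = 0) ->
  homoclinic alpha x -> x = 0.
Proof.
move=> ct tn ft f0 zf z1 fmin hx.
pose v := frac_orbit t x.
have vv : vanishing (fun n => toC (v n)) by exact: frac_orbit_vanishing.
pose h n := polyact int_succ (mapR f) v n.
have hint n : h n \is a Num.int by exact: frac_orbit_int.
have hC n : polyact int_succ (mapC f) (fun m => toC (v m)) n = toC (h n) by exact: polyact_toC.
have [N HN] : exists N : nat, forall n : int, (N%:Z <= n) || (n < - N%:Z) -> h n = 0.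
  have [N HN] := vanishing_polyact (mapC f) vv ltr01.
  exists N => n Nn; apply: int_small => //.
  by rewrite -normc_real -hC; apply: HN; lia.
pose H := \poly_(j < N + N) Num.floor (h (N%:Z - 1 - j%:Z)).
have Hz : root (mapC H) z.
  have sH : (size (mapC H) <= N + N)%N by exact: leq_trans (size_poly _ _) (size_poly _ _).
  rewrite /root (horner_coef_wide _ sH); apply/eqP.
  rewrite -[RHS](vanishing_root zf z1 vv (N := N)).
    apply: eq_bigr => j _; rewrite coef_map coef_poly ltn_ord hC /=.
    by rewrite -[in RHS](floorK (hint (N%:Z - 1 - j%:Z))) rmorph_int.
  by move=> n /HN h0; rewrite hC h0.
have [c [q [b [c0 E sb]]]] := pseudo_division H f0.
have {sb}b0 : b = 0.
  apply: fmin sb.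
  have Eb : b = c%:P * H - q * f by rewrite E addrAC subrr add0r.
  rewrite /root Eb rmorphB !rmorphM /= hornerD hornerN !hornerM.
  by rewrite (eqP zf) (eqP Hz) !mulr0 subrr.
rewrite {}b0 addr0 in E.
pose G (m : int) : int := if m is Posz j then q`_j else 0.
pose g (n : int) : R := (G (N%:Z - 1 - n))%:~R.
have gh n : polyact int_succ (mapR f) g n = c%:~R * h n.
  have shiftg i : g (iter i int_succ n) = (G (N%:Z - 1 - n - i%:Z))%:~R.
    by rewrite /g iter_int_succ opprD addrA.
  case En : (N%:Z - 1 - n) => [j|j]; last first.
    rewrite HN ?mulr0; last by lia.
    rewrite /polyact big1// => i _; rewrite shiftg En.
    have -> : Negz j - (i : nat)%:Z = Negz (j + i) by lia.
    by rewrite mulr0.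
  have -> : c%:~R * h n = ((f * q)`_j)%:~R.
    rewrite (mulrC f q) -E coefCM intrM; congr (_ * _); rewrite coef_poly.
    have nE : n = N%:Z - 1 - j%:Z by lia.
    case: ltnP => jN; first by rewrite -nE floorK.
    by rewrite HN//; lia.
  rewrite coefM rmorph_sum /=.
  have wide : (size (mapR f) <= size f + j.+1)%N.
    by apply: leq_trans (size_poly _ _) (leq_addr _ _).
  rewrite (polyact_wide _ _ _ wide).
  rewrite (big_ord_widen (size f + j.+1) (fun i => (f`_i * q`_(j - i))%:~R) (leq_addl _ _)).
  have GE (k : nat) : G (Posz j - k%:Z) = if (k < j.+1)%N then q`_(j - k) else 0.
    case: ltnP => kj; first by rewrite subzn.
    by have -> : Posz j - k%:Z = Negz (k - j.+1)%N by lia.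
  rewrite [RHS]big_mkcond; apply: eq_bigr => i _; rewrite coef_map shiftg En GE /=.
  by case: ifP => _; rewrite ?mulr0 ?intrM.
pose u n := c%:~R * v n - g n.
have u0 n : toC (u n) = 0.
  apply: (@vanishing_kill R (mapC f) (fun m => toC (u m))) => //; first exact: mapC_neq0.
    have c1 : 0 < `|c%:~R| + 1 :> R by rewrite ltr_wpDl.
    move=> e e0; have [M HM] := vv _ (divr_gt0 e0 c1).
    exists (M + N + size q).+1 => m Mm.
    have -> : u m = c%:~R * v m.
      rewrite /u (_ : g m = 0) ?subr0// /g.
      case Em : (N%:Z - 1 - m) => [j|//] /=; rewrite nth_default//.
      by move: Mm Em; move: (size q) => s; clear; lia.
    rewrite normc_real normrM; have := HM m ltac:(lia); rewrite normc_real.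
    rewrite ltr_pdivlMr// => hv; apply: le_lt_trans hv.
    by rewrite mulrC ler_wpM2l// lerDl.
  move=> m; rewrite polyact_toC /u polyact_sub polyact_scale gh -/(h m).
  by rewrite subrr.
have Yx n : c%:~R * t (aut_iter alpha n x) \is a Num.int.
  have /(congr1 (@complex.Re R)) /= /eqP := u0 n; rewrite subr_eq0 => /eqP e.
  have -> : t (aut_iter alpha n x) = v n + nearest_int (t (aut_iter alpha n x)).
    by rewrite /v /frac_orbit subrK.
  by rewrite mulrDr e rpredD ?rpredM ?nearest_int_int ?intr_int.
apply: (@homoclinic_finite (orbit_kernel alpha (fun y => c%:~R * t y))) => //.
  apply: orbit_kernel_finite => //; first exact: characterZ.
  exact: character_scale_nontrivial.
by move=> n m; rewrite -aut_iterD.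
Qed.

End Homoclinic.

Theorem corollary4p2 (R : realType) (X : topologicalZmodType)
    (compactX : compact [set: X]) (hausdorffX : hausdorff_space X)
    (connectedX : connected [set: X])
    (mu : probability (borelType X) R) (haar_mu : haar_probability mu)
    (alpha : continuous_automorphism X)
    (irreducible_alpha : irreducible_aut alpha)
    (ergodic_alpha : ergodic_aut mu alpha)
    (nonexpansive_alpha : ~ expansive_aut alpha) :
  homoclinic alpha = [set 0].
Proof.
apply/seteqP; split => [x hx|_ ->]; last first.
  rewrite /homoclinic /= (_ : (fun n => _) = (fun=> 0)); first exact: cvg_cst.
  by apply/funext => n; rewrite aut_iter0r.
have [x0|/eqP xn0] := pselect (x = 0); first by [].
have [t ct tn] : exists2 t : X -> R, character t & nontrivial t.
  by apply: character_exists => //; exists x.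
have [t' [f [z [ct' tn' ft [f0 zf z1 fmin]]]]] := critical_character compactX hausdorffX
  connectedX irreducible_alpha nonexpansive_alpha (ex_intro2 _ _ t ct tn).
exact: (homoclinic_trivial compactX hausdorffX connectedX irreducible_alpha
  ct' tn' ft f0 zf z1 fmin hx).
Qed.
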